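(* Let $K$ be a field, $S=K[x_1,\dots,x_n]$, and let $I\subseteq S$ be a left PLP-polymatroidal ideal. Then $\operatorname{dstab}(I)=\operatorname{astab}(I)=1$.
   Context: For a monomial ideal $I\subseteq S$, $\operatorname{dstab}(I)$ (resp. $\operatorname{astab}(I)$) is the smallest positive integer $m$ such that $\operatorname{depth} S/I^m=\operatorname{depth} S/I^\ell$ (resp. $\operatorname{Ass}(S/I^m)=\operatorname{Ass}(S/I^\ell)$) for all $\ell\ge m$. Left PLP-polymatroidal ideal: let $n,k,d$ be positive integers with $1\le k\le n-1$, let $b_1,\dots,b_k$ be positive integers and let $\alpha_i,\beta_i$ $(k+1\le i\le n)$ be non-negative integers with $\alpha_i\le\beta_i$ for all $i$, $\alpha_{k+1}\le\cdots\le\alpha_n=d$ and $\beta_{k+1}\le\cdots\le\beta_n=d$. The corresponding left PLP-polymatroidal ideal $I$ is the monomial ideal of $S$ generated by all $x_1^{u_1}\cdots x_n^{u_n}$, with $u_i$ non-negative integers, such that $0\le u_i\le b_i$ for $1\le i\le k$ and $\alpha_i\le u_1+\cdots+u_i\le\beta_i$ for $i=k+1,\dots,n$. *)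

(* Defs.v *)
From HB Require Import structures.
From mathcomp Require Import all_boot all_order all_algebra.
From mathcomp Require Import mpoly.

Set Implicit Arguments.
Unset Strict Implicit.
Unset Printing Implicit Defensive.

Import GRing.Theory.
Local Open Scope ring_scope.

(* Ideals are Prop-valued predicates, since membership is not assumed to be
   decidable; two ideals are equal when the predicates are equivalent. *)
Section Ideals.
Variable R : comNzRingType.
Implicit Types (I J P G : R -> Prop) (s : seq R).

Definition ideal_gen G : R -> Prop := fun f =>
  exists2 c : seq (R * R),
    forall p, p \in c -> G p.2 & f = \sum_(p <- c) p.1 * p.2.

Definition ideal_mul I J : R -> Prop :=
  ideal_gen (fun h => exists f g, [/\ I f, J g & h = f * g]).

Fixpoint ideal_pow I (m : nat) : R -> Prop :=
  if m is m'.+1 then ideal_mul I (ideal_pow I m') else fun=> True.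

Definition prime_ideal P : Prop :=
  [/\ P 0,
      forall f g, P f -> P g -> P (f + g),
      forall f g, P g -> P (f * g),
      ~ P 1
    & forall f g, P (f * g) -> P f \/ P g].

(* P belongs to Ass(R/J): P is a prime ideal and is the annihilator of the
   class of some f in R/J. *)
Definition Ass J P : Prop :=
  prime_ideal P /\ exists f, forall g, P g <-> J (g * f).

Definition same_Ass I J : Prop := forall P, Ass I P <-> Ass J P.

Definition ideal_adjoin J s : R -> Prop :=
  ideal_gen (fun g => J g \/ g \in s).

(* s is a regular sequence on R/J with entries in the ideal M. *)
Definition regular_seq M J s : Prop :=
  [/\ forall f, f \in s -> M f,
      forall i f, (i < size s)%N ->
        ideal_adjoin J (take i s) (s`_i * f) -> ideal_adjoin J (take i s) f
    & ~ ideal_adjoin J s 1].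

(* The grade of M on R/J, as the maximal length of a regular sequence on R/J
   with entries in M. *)
Definition has_grade M J (r : nat) : Prop :=
  (exists2 s, regular_seq M J s & size s = r) /\
  (forall s, regular_seq M J s -> (size s <= r)%N).

End Ideals.

Definition is_stability_index (same : nat -> nat -> Prop) (m : nat) : Prop :=
  let stable_from m' := forall l, (m' <= l)%N -> same m' l in
  [/\ (0 < m)%N,
      stable_from m
    & forall m', (0 < m')%N -> stable_from m' -> (m <= m')%N].

Section Polynomials.
Variables (K : fieldType) (n : nat).
Implicit Types (I J : {mpoly K[n]} -> Prop).

Definition graded_max_ideal : {mpoly K[n]} -> Prop :=
  ideal_gen (fun g => exists i : 'I_n, g = 'X_i).

Definition has_depth J (r : nat) : Prop := has_grade graded_max_ideal J r.

Definition same_depth I J : Prop := exists2 r, has_depth I r & has_depth J r.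

Definition is_dstab I : nat -> Prop :=
  is_stability_index (fun m l => same_depth (ideal_pow I m) (ideal_pow I l)).

Definition is_astab I : nat -> Prop :=
  is_stability_index (fun m l => same_Ass (ideal_pow I m) (ideal_pow I l)).

(* Indices are shifted to start at 0: the indices 1, ..., k become the i < k,
   the indices k+1, ..., n become the i >= k, and u_1 + ... + u_i becomes the
   sum of the u j with j <= i.  Only the values b i for i < k and alpha i,
   beta i for i >= k matter. *)
Definition left_PLP_params (k d : nat) (b alpha beta : 'I_n -> nat) : Prop :=
  [/\ (0 < k < n)%N /\ (0 < d)%N,
      forall i : 'I_n, (i < k)%N -> (0 < b i)%N,
      forall i : 'I_n, (k <= i)%N -> (alpha i <= beta i)%N,
      forall i j : 'I_n, (k <= i)%N -> (i <= j)%N ->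
        (alpha i <= alpha j)%N /\ (beta i <= beta j)%N
    & forall i : 'I_n, i.+1 = n -> alpha i = d /\ beta i = d].

Definition left_PLP_exponent (k : nat) (b alpha beta : 'I_n -> nat)
    (u : 'X_{1..n}) : Prop :=
  (forall i : 'I_n, (i < k)%N -> (u i <= b i)%N) /\
  (forall i : 'I_n, (k <= i)%N ->
     (alpha i <= \sum_(j < n | (j <= i)%N) u j <= beta i)%N).

Definition left_PLP_ideal (k : nat) (b alpha beta : 'I_n -> nat) :
    {mpoly K[n]} -> Prop :=
  ideal_gen (fun g => exists2 u : 'X_{1..n},
    left_PLP_exponent k b alpha beta u & g = 'X_[u]).

End Polynomials.

Arguments left_PLP_ideal K {n} k b alpha beta _.

(* Main.v *)
(* Write [lo t <= u_1 + ... + u_t <= hi t] for the constraints on prefix sums.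
   Rounding down the prefix sums divided by [m] splits a summand off a lattice
   point of the [m]-th dilation, so [I^m] is the ideal with all bounds multiplied
   by [m]; it is enough to see that [Ass] and depth only depend on comparisons between
   homogeneous expressions in the bounds.
   Ass: the greedy choice of prefix sums gives a Hall-type criterion for a
   monomial to lie in [I].  A monomial prime [P_F] is associated iff some
   constraint between positions [j < i] can fail by exactly 1 while everything
   else holds after adding any variable of [F], which reads as strict
   inequalities between the bounds ([assoc_cond]).
   Depth: the positions [t] with [lo t = hi t] cut the exponent polytope into a
   product of [c] blocks.  Taking [p_1, ..., p_c] to be the last variables of the
   blocks, the differences [x_{p_1} - x_{p_j}] form a regular sequence modulo
   which [x^A / x_p] is a socle element, where [A] has the prefix sums [lo].
   Hence the depth is [c - 1]. *)
Require Import Defs.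
From HB Require Import structures.
From mathcomp Require Import all_boot all_order all_algebra.
From mathcomp Require Import mpoly.
From mathcomp Require Import zify.
From Stdlib Require Import Classical IndefiniteDescription.
From Stdlib Require Import FunctionalExtensionality PropExtensionality.

Set Implicit Arguments.
Unset Strict Implicit.
Unset Printing Implicit Defensive.

Import GRing.Theory.
Local Open Scope nat_scope.

Lemma leq_sum_term (f : nat -> nat) p q x :
  p <= x < q -> f x <= \sum_(p <= y < q) f y.
Proof.
case/andP=> px xq; rewrite (@big_cat_nat _ _ _ x p q) ?(ltnW xq) //= (big_ltn xq).
lia.
Qed.

(** * Lattice points with bounded prefix sums, the greedy choice and the Hall criterion *)

Section PrefixBounds.
Variables n k : nat.
Implicit Types (b lo hi u v w : nat -> nat) (F : pred nat).

(** Bounds are indexed by the length [t] of a prefix, from 0 to [n]. A short prefix, [0 < t <= k],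
    inherits the upper bound at [k.+1], so that all prefixes are treated alike; caps [b] concern the
    first [k] variables. *)
Record PLP_bounds b lo hi : Prop := PLPBounds {
  PLP_kn : k < n;
  PLP_b : forall x, x < k -> 0 < b x;
  PLP_lo : forall s t, s <= t -> t <= n -> lo s <= lo t;
  PLP_hi : forall s t, s <= t -> t <= n -> hi s <= hi t;
  PLP_lohi : forall t, t <= n -> lo t <= hi t;
  PLP_lo0 : forall t, t <= k -> lo t = 0;
  PLP_hi0 : hi 0 = 0;
  PLP_hik : forall t, 0 < t <= k -> hi t = hi k.+1;
  PLP_last : lo n = hi n;
  PLP_pos : 0 < lo n }.

Definition psum u t := \sum_(0 <= x < t) u x.

Lemma psumS u t : psum u t.+1 = psum u t + u t.
Proof. by rewrite /psum big_nat_recr. Qed.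

Lemma psum0 u : psum u 0 = 0.
Proof. by rewrite /psum big_geq. Qed.

Definition is_base b lo hi u : Prop :=
  (forall x, x < k -> u x <= b x) /\
  (forall t, t <= n -> lo t <= psum u t <= hi t).

Definition feasible b lo hi v : Prop :=
  exists2 u, is_base b lo hi u & forall x, x < n -> u x <= v x.

Definition capped b v x := if x < k then minn (b x) (v x) else v x.

(** The largest prefix sums compatible with the caps and with [hi]. *)
Fixpoint greedy b hi v t :=
  if t is t'.+1 then minn (hi t) (greedy b hi v t' + capped b v t') else 0.

(** As [hi] is monotone, the greedy prefix sums never decrease, so their successive differences form
    an exponent. *)
Lemma feasible_greedy b lo hi v : PLP_bounds b lo hi ->
  (forall t, t <= n -> lo t <= greedy b hi v t) -> feasible b lo hi v.
Proof.
move=> H Hlo.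
have Mhi t : t <= n -> greedy b hi v t <= hi t.
  by case: t => [|t] _ //=; rewrite geq_minl.
have Mmono t : t < n -> greedy b hi v t <= greedy b hi v t.+1.
  move=> tn /=; have := Mhi _ (ltnW tn); have := PLP_hi H (leqnSn t) tn; lia.
pose u x := greedy b hi v x.+1 - greedy b hi v x.
have ps t : t <= n -> psum u t = greedy b hi v t.
  elim: t => [|t IH] tn; first by rewrite psum0.
  by rewrite psumS IH 1?ltnW // /u addnC subnK // Mmono.
have uc x : u x <= capped b v x by rewrite /u /=; lia.
exists u; first split.
- by move=> x xk; apply: leq_trans (uc x) _; rewrite /capped xk geq_minl.
- by move=> t tn; rewrite ps // Hlo // Mhi.
by move=> x xn; apply: leq_trans (uc x) _; rewrite /capped; case: ifP => // _; lia.
Qed.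

(** An induction keeps [s] below the greedy path. The path [s] may drop, which gives freedom in
    choosing it. *)
Lemma feasible_path b lo hi v s : PLP_bounds b lo hi ->
  s 0 = 0 -> (forall t, t <= n -> lo t <= s t <= hi t) ->
  (forall t, t < n -> s t.+1 <= s t + capped b v t) -> feasible b lo hi v.
Proof.
move=> H s0 Hs Hc; apply: feasible_greedy => // t tn.
suff : s t <= greedy b hi v t by have := Hs t tn; lia.
elim: t tn => [|t IH] tn /=; first by rewrite s0.
have := IH (ltnW tn); have := Hc _ tn; have := Hs _ tn; lia.
Qed.

(** Here [j] is the last position where the minimum is [hi j]; from there on the greedy sums grow by
    the full caps. *)
Lemma greedy_hall b hi v t : hi 0 = 0 ->
  exists2 j, j <= t & greedy b hi v t = hi j + \sum_(j <= x < t) capped b v x.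
Proof.
move=> h0; elim: t => [|t [j jt IH]]; first by exists 0 => //; rewrite big_geq // h0.
rewrite /=; case: (leqP (hi t.+1) (greedy b hi v t + capped b v t)) => _.
  by exists t.+1 => //; rewrite big_geq // addn0.
exists j; first exact: leqW.
by rewrite big_nat_recr //= IH addnA.
Qed.

Lemma infeasible_hall b lo hi v : PLP_bounds b lo hi -> ~ feasible b lo hi v ->
  exists j i, [/\ j <= i, i <= n & hi j + \sum_(j <= x < i) capped b v x < lo i].
Proof.
move=> H nf.
have [/forallP all_lo | ] := boolP [forall t : 'I_n.+1, lo t <= greedy b hi v t].
  by case: nf; apply: feasible_greedy => // t tn; apply: (all_lo (Ordinal (tn : t < n.+1))).
rewrite negb_forall => /existsP [[t /= tn]]; rewrite -ltnNge => lt_lo.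
have [j jt Mt] := greedy_hall b v t (PLP_hi0 H).
by exists j, t; rewrite -Mt.
Qed.

Lemma feasible_hall b lo hi v j i : feasible b lo hi v -> j <= i -> i <= n ->
  lo i <= hi j + \sum_(j <= x < i) capped b v x.
Proof.
case=> u [ub us] uv ji i_n.
have /andP[lo_i _] := us _ i_n; have /andP[_ hi_j] := us _ (leq_trans ji i_n).
apply: leq_trans lo_i _; rewrite /psum (big_cat_nat (n := j)) //=.
apply: leq_add => //; rewrite big_nat_cond [leqRHS]big_nat_cond.
apply: leq_sum => x /andP[/andP[jx xi] _]; have := uv x (leq_trans xi i_n).
rewrite /capped; case: ifP => // xk; have := ub x xk; lia.
Qed.

(** * Combinatorics of associated monomial primes *)

(* The monomial prime of the variables in [F] is associated to the ideal iff this
   holds.  [base] is the largest prefix sum at [i] that can be reached from the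
   bound [hi j] without using the variables in [F]. *)
Definition assoc_cond b lo hi F : Prop := exists j i,
  let base := hi j + \sum_(j <= x < i | ~~ F x) b x in
  [/\ j < i <= n, forall x, x < n -> F x -> j <= x < i,
      forall x, j <= x < i -> ~~ F x -> x < k,
      base < lo i
    & forall t, j < t < i -> [/\ lo t < hi t, lo t < lo i & base < hi t]].

Definition scale m (f : nat -> nat) x := m * f x.

(** Each inequality between bounds in [assoc_cond] is homogeneous of degree one, so a positive
    factor cancels. *)
Lemma assoc_cond_scale m b lo hi F : 0 < m ->
  assoc_cond (scale m b) (scale m lo) (scale m hi) F <->
  assoc_cond b lo hi F.
Proof.
rewrite /scale => m0; split=> [] [j [i [ji Fji Nk base_lo mid]]]; exists j, i; split=> //.
- by move: base_lo; rewrite /= -big_distrr -mulnDr ltn_pmul2l.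
- by move=> t /mid; rewrite /= -big_distrr -mulnDr !ltn_pmul2l.
- by rewrite /= -big_distrr -mulnDr ltn_pmul2l.
- by move=> t /mid; rewrite /= -big_distrr -mulnDr !ltn_pmul2l.
Qed.


Definition assoc_witness b lo hi F : Prop :=
  exists w, forall u, feasible b lo hi (fun x => u x + w x) <->
    exists x, [/\ x < n, F x & 0 < u x].

(** Without a variable of [F] the prefix sums stay below [tau], which misses [lo i] by one. A
    variable of [F] lets the path rise by one, and the strict inequalities strictly between [j] and
    [i] leave room for this. *)
Lemma assoc_cond_witness b lo hi F : PLP_bounds b lo hi ->
  assoc_cond b lo hi F -> assoc_witness b lo hi F.
Proof.
move=> H [j [i /= [/andP[ji i_n] Fji Nk base_lo mid]]].
pose g t := hi j + \sum_(j <= x < t | ~~ F x) b x.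
rewrite -/(g i) in base_lo mid.
(* [tau] is the target sequence of prefix sums: as low as the lower bounds
   permit, and one below [lo i] at the position [i]. *)
pose tau t := maxn (g t) (minn (lo t) (lo i).-1).
(* [N] dominates all caps and all bounds on prefix sums, so an entry [N] of [w] imposes no
   restriction of its own. *)
pose N := lo n + \sum_(0 <= x < k) b x.
have Nd : lo n <= N by rewrite leq_addr.
have Nb x : x < k -> b x <= N.
  move=> xk; have := @leq_sum_term b 0 k x; rewrite /N; lia.
pose w x := if F x then tau x.+1 - tau x else N.
have gS t : j <= t -> g t.+1 = g t + (~~ F t) * b t.
  move=> jt; rewrite /g big_mkcond big_nat_recr //= -big_mkcond addnA.
  by case: (F t); rewrite ?mul1n.
have g_base t : j <= t -> t <= i -> g t <= g i.
  by move=> jt ti; rewrite /g (@big_cat_nat _ _ _ t j i) //=; lia.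
have loi_n : lo i <= lo n by apply: (PLP_lo H).
have ki : k < i by case: (leqP i k) => // /(PLP_lo0 H) e; rewrite e in base_lo.
(* If [0 < j <= k], then [hi j = hi k.+1] is at most the base [g i]. This contradicts
   [g i < hi k.+1], or [g i < lo i <= hi i] when [i = k.+1]. *)
have j_gt : 0 < j -> k < j.
  move=> j0; case: (leqP j k) => // jk; exfalso.
  have hj : hi j = hi k.+1 by apply: (PLP_hik H); rewrite j0.
  have hg : hi j <= g i by rewrite leq_addr.
  case: (ltnP k.+1 i) => k1i.
    by have [] := mid k.+1; [lia | move=> _ _; lia].
  have e : i = k.+1 by lia.
  by have := PLP_lohi H i_n; rewrite e in base_lo hg *; lia.
have tau_i : tau i = (lo i).-1 by rewrite /tau; lia.
have tau_lo t : t <= k -> tau t = g t by move=> tk; rewrite /tau (PLP_lo0 H) // min0n maxn0.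
have tauF x : j <= x < i -> F x -> tau x <= tau x.+1.
  move=> /andP[jx xi] Fx; rewrite /tau gS // Fx.
  have := PLP_lo H (leqnSn x) (leq_trans xi i_n); lia.
have tauS x : j <= x < i -> tau x.+1 = tau x + (if F x then w x else b x).
  move=> jxi; case: ifP => Fx; first by rewrite /w Fx subnKC // tauF.
  have xk : x < k by apply: Nk; rewrite ?Fx.
  rewrite !tau_lo ?(ltnW xk) // gS; last by case/andP: jxi.
  by rewrite Fx mul1n.
exists w => u; split.
- move=> [u' [ub us] uw].
  have [/existsP [x /andP[Fx ux]] | ] := boolP [exists x : 'I_n, F x && (0 < u x)].
    by exists x; rewrite Fx ux ltn_ord.
  rewrite negb_exists => /forallP none; exfalso.
  have none' x : x < n -> F x -> u x = 0.
    by move=> xn Fx; have := none (Ordinal xn); rewrite /= Fx /= lt0n negbK => /eqP.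
  (* With [u] zero on [F], the entries of [u'] are at most [w] on [F] and [b] off [F], which are the
     increments of [tau]. *)
  have key t : j <= t -> t <= i -> psum u' t <= tau t.
    elim: t => [|t IH] jt ti; first by rewrite psum0.
    case: (ltnP t j) => tj.
      have e : t.+1 = j by lia.
      rewrite e; have /andP[_ ] := us j (ltnW (leq_trans ji i_n)).
      by move=> h; apply: leq_trans h _; rewrite /tau /g; lia.
    rewrite psumS tauS; last by rewrite tj.
    apply: leq_add; first by apply: IH => //; apply: ltnW.
    have tn : t < n := leq_trans ti i_n.
    have := uw _ tn; case: ifP => Ft; first by rewrite none'.
    by move=> _; apply: ub; apply: Nk; rewrite ?tj ?Ft.
  have := key i (ltnW ji) (leqnn i); rewrite tau_i.
  by have /andP[+ _] := us i i_n; lia.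
move=> [x0 [x0n Fx0 ux0]].
have /andP[jx0 x0i] := Fji _ x0n Fx0.
(* Between [j] and [i] the path follows [tau], raised by one after [x0]. Elsewhere it is 0 up to [k]
   and [hi] beyond, the jumps being absorbed by entries [N]. *)
pose s t := if j <= t <= i then tau t + (x0 < t) else if t <= k then 0 else hi t.
have s_bd t : t <= n -> lo t <= s t <= hi t.
  move=> tn; rewrite /s; case: ifP => [/andP[jt ti] | _]; last first.
    case: ifP => tk; last by rewrite (PLP_lohi H) //=.
    by rewrite (PLP_lo0 H).
  case: (eqVneq t i) => [-> | ti'].
    rewrite tau_i x0i; have := PLP_lohi H i_n; lia.
  case: (eqVneq t j) => [-> | tj'].
    rewrite ltnNge jx0 /= addn0 /tau /g big_geq // addn0.
    have := PLP_lohi H (ltnW (leq_trans ji i_n)).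
    have := PLP_lo H (ltnW ji) i_n; lia.
  have [lt_lohi lt_lo lt_base] : [/\ lo t < hi t, lo t < lo i & g i < hi t] by apply: mid; lia.
  have := g_base t jt ti; rewrite /tau; lia.
apply: (@feasible_path _ _ _ _ s H) => //.
- rewrite /s; case: ifP => // /andP[j0 _].
  have e : j = 0 by lia.
  by rewrite tau_lo // /g e big_geq // (PLP_hi0 H).
move=> x xn.
have s_d : s x.+1 <= lo n.
  have /andP[_ h] := s_bd _ xn; apply: leq_trans h _.
  by rewrite (PLP_last H); apply: (PLP_hi H).
have [Fx | NFx] := boolP (F x).
  have /andP[jx xi] := Fji _ xn Fx.
  have wx : w x = tau x.+1 - tau x by rewrite /w Fx.
  have u0 : (x == x0) <= u x by case: eqP => // ->.
  have -> : s x = tau x + (x0 < x) by rewrite /s jx (ltnW xi).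
  have -> : s x.+1 = tau x.+1 + (x0 < x.+1) by rewrite /s (leqW jx) xi.
  have := tauF x; rewrite jx xi => /(_ isT Fx) mono.
  rewrite /capped; case: ifP => [xk | _]; last by lia.
  (* Below [k], [tau] is constant across a variable of [F], so the increment is at most 1, within
     the positive cap [b x]. *)
  rewrite !tau_lo // ?(ltnW xk) // gS // Fx in mono wx *.
  have := PLP_b H xk; lia.
rewrite /capped; case: ltnP => xk; last by rewrite /w (negbTE NFx); lia.
have -> : minn (b x) (u x + w x) = b x.
  by apply/minn_idPl; rewrite /w (negbTE NFx); have := Nb x xk; lia.
have [/andP[jx1 x1i] | h] := boolP (j <= x.+1 <= i); last first.
  by rewrite {1}/s (negbTE h) xk.
have jx : j <= x by lia.
have -> : s x = tau x + (x0 < x) by rewrite /s jx (ltnW x1i).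
have -> : s x.+1 = tau x.+1 + (x0 < x.+1) by rewrite /s jx1 x1i.
rewrite !tau_lo ?(ltnW xk) // gS // NFx.
have : x != x0 by apply: contraNneq NFx => ->.
lia.
Qed.

(** The pair [j], [i] is a violated Hall inequality that every single variable of [F] repairs;
    comparing it with the inequalities that must already hold gives the strict bounds in between. *)
Lemma witness_assoc_cond b lo hi F : PLP_bounds b lo hi ->
  assoc_witness b lo hi F -> assoc_cond b lo hi F.
Proof.
move=> H [a Ha].
pose N := lo n + \sum_(0 <= x < k) b x.
have Nd : lo n <= N by rewrite leq_addr.
have Nb x : x < k -> b x <= N.
  move=> xk; have := @leq_sum_term b 0 k x; rewrite /N; lia.
(* Multiplying [x^a] by high powers of the variables outside [F] does not reach the ideal. *)
pose v x := (if F x then 0 else N) + a x.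
have nfv : ~ feasible b lo hi v.
  by move/Ha => [x [_ Fx]]; rewrite Fx.
pose ve x0 x := ((if F x then 0 else N) + (x == x0)) + a x.
have fve x0 : x0 < n -> F x0 -> feasible b lo hi (ve x0).
  move=> x0n Fx0; apply/Ha; exists x0; rewrite x0n Fx0; split=> //.
  by rewrite eqxx addn1.
have [j [i [ji i_n viol]]] := infeasible_hall H nfv.
set c := capped b v in viol.
have c_ve x0 x : capped b (ve x0) x <= c x + (x == x0).
  by rewrite /c /capped /ve /v; case: (F x); case: (x < k); lia.
have c_ve' x0 p q : ~~ (p <= x0 < q) ->
    \sum_(p <= x < q) capped b (ve x0) x <= \sum_(p <= x < q) c x.
  move=> out; rewrite big_nat_cond [leqRHS]big_nat_cond.
  apply: leq_sum => x /andP[pxq _].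
  by have := c_ve x0 x; case: eqP out => [<- | _ _]; [rewrite pxq | rewrite addn0].
(* Adding [x0] does not affect an interval that misses it, so the Hall inequality there already
   holds for [v]. *)
have hall x0 p q : x0 < n -> F x0 -> p <= q -> q <= n -> ~~ (p <= x0 < q) ->
    lo q <= hi p + \sum_(p <= x < q) c x.
  move=> x0n Fx0 pq qn out.
  have := feasible_hall (fve _ x0n Fx0) pq qn; have := c_ve' x0 p q out; lia.
have sum1 x0 p q : p <= x0 < q ->
    \sum_(p <= x < q) capped b (ve x0) x <= (\sum_(p <= x < q) c x).+1.
  move=> /andP[px xq].
  rewrite (@big_cat_nat _ _ _ x0 p q) ?(ltnW xq) //=.
  rewrite [in leqRHS](@big_cat_nat _ _ _ x0 p q) ?(ltnW xq) //=.
  rewrite (big_ltn xq) [in leqRHS](big_ltn xq).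
  have := c_ve x0 x0; rewrite eqxx.
  have := c_ve' x0 p x0; rewrite ltnn andbF => /(_ isT).
  have := c_ve' x0 x0.+1 q; rewrite ltnn => /(_ isT); lia.
have Fji x : x < n -> F x -> j <= x < i.
  move=> xn Fx; apply/negPn/negP => out; have := hall x j i xn Fx ji i_n out; lia.
have loi_n : lo i <= lo n by apply: (PLP_lo H).
have c_le x : j <= x < i -> c x <= \sum_(j <= y < i) c y.
  exact: leq_sum_term.
have Nk x : j <= x < i -> ~~ F x -> x < k.
  move=> jxi NFx; case: (ltnP x k) => // kx.
  have := c_le x jxi; rewrite {1}/c /capped ltnNge kx /= /v (negbTE NFx); lia.
have cN x : j <= x < i -> ~~ F x -> c x = b x.
  move=> jxi NFx; have xk := Nk x jxi NFx.
  by rewrite /c /capped xk /v (negbTE NFx); have := Nb x xk; lia.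
have base_le t : t <= i -> \sum_(j <= x < t | ~~ F x) b x <= \sum_(j <= x < t) c x.
  move=> ti; rewrite big_mkcond big_nat_cond [leqRHS]big_nat_cond.
  apply: leq_sum => x /andP[/andP[jx xt] _]; case: ifP => // NFx.
  by rewrite cN // jx (leq_trans xt ti).
have ki : k < i by case: (leqP i k) => // /(PLP_lo0 H) e; rewrite e in viol.
have ji' : j < i.
  case: (ltnP j i) => // ij; have e : i = j by lia.
  by move: viol; rewrite big_geq // addn0 e; have := PLP_lohi H i_n; rewrite e; lia.
have Fk x : k <= x -> j <= x < i -> F x.
  by move=> kx jxi; apply: contraLR kx => /(Nk x jxi); rewrite -ltnNge.
have base_lo : hi j + \sum_(j <= x < i | ~~ F x) b x < lo i.
  by have := base_le i (leqnn i); lia.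
have Fi : F i.-1 by apply: Fk; lia.
have tail t : k < t -> t <= i ->
    \sum_(j <= x < i | ~~ F x) b x = \sum_(j <= x < t | ~~ F x) b x.
  case: (leqP j t) => [jt | tj] kt ti; last first.
    have Fall x : j <= x < i -> F x by move=> /[dup] jxi /andP[jx xi]; apply: Fk => //; lia.
    rewrite big_nat_cond big1 ?(big_geq (ltnW tj)) //.
    by move=> x /andP[jxi]; rewrite Fall.
  rewrite (@big_cat_nat _ _ _ t j i) //= [X in _ + X]big_nat_cond [X in _ + X]big1 ?addn0 //.
  move=> x /andP[/andP[tx xi]]; rewrite Fk //; lia.
(* The intervals from [t] to [i] and from [j] to [t] miss the elements [t.-1] and [i.-1] of [F];
   their Hall inequalities are played against the violated one. *)
have mid_k t : j < t < i -> k < t ->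
    [/\ lo t < hi t, lo t < lo i & hi j + \sum_(j <= x < i | ~~ F x) b x < hi t].
  move=> /andP[jt ti] kt.
  have tn : t <= n by lia.
  have Ft : F t.-1 by apply: Fk; lia.
  have split_t : \sum_(j <= x < i) c x = \sum_(j <= x < t) c x + \sum_(t <= x < i) c x.
    by rewrite (@big_cat_nat _ _ _ t j i) //=; lia.
  have h1 := hall t.-1 t i _ Ft (ltnW ti) i_n.
  have h2 := hall i.-1 j t _ Fi (ltnW jt) tn.
  have h3 := tail t kt (ltnW ti); have h4 := base_le t (ltnW ti).
  have {h1} : lo i <= hi t + \sum_(t <= x < i) c x by apply: h1; lia.
  have {h2} : lo t <= hi j + \sum_(j <= x < t) c x by apply: h2; lia.
  by split; lia.
exists j, i; split=> //; first by rewrite ji' i_n.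
move=> t /andP[jt ti]; case: (ltnP k t) => kt; first by apply: mid_k => //; rewrite jt ti.
(* Up to [k] the lower bound is 0 and the upper bound is that of [k.+1], so only the latter position
   has to be examined. *)
have ht : hi t = hi k.+1 by apply: (PLP_hik H); rewrite kt andbT; lia.
have lt0 : lo t = 0 by apply: (PLP_lo0 H).
have hb : hi j + \sum_(j <= x < i | ~~ F x) b x < hi k.+1.
  case: (ltnP k.+1 i) => k1i; first by have [] := mid_k k.+1; lia.
  have e : k.+1 = i by lia.
  by have := PLP_lohi H i_n; rewrite e; lia.
rewrite ht lt0; split=> //; lia.
Qed.

(** * Dilations and the splitting of lattice points *)

Lemma PLP_bounds_scale m b lo hi : 0 < m -> PLP_bounds b lo hi ->
  PLP_bounds (scale m b) (scale m lo) (scale m hi).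
Proof.
move=> m0 [kn bp lom him lohi lo0 hi0 hik last pos].
rewrite /scale; split=> //.
- by move=> x xk; rewrite muln_gt0 m0 bp.
- by move=> s t st tn; rewrite leq_mul2l lom ?orbT.
- by move=> s t st tn; rewrite leq_mul2l him ?orbT.
- by move=> t tn; rewrite leq_mul2l lohi ?orbT.
- by move=> t tk; rewrite lo0 ?muln0.
- by rewrite hi0 muln0.
- by move=> t tk; rewrite (hik t).
- by rewrite last.
- by rewrite muln_gt0 m0.
Qed.

Lemma psumD u v t : psum (fun x => u x + v x) t = psum u t + psum v t.
Proof. exact: big_split. Qed.

Lemma is_base_add m b lo hi u v :
  is_base b lo hi u -> is_base (scale m b) (scale m lo) (scale m hi) v ->
  is_base (scale m.+1 b) (scale m.+1 lo) (scale m.+1 hi) (fun x => u x + v x).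
Proof.
move=> [ub us] [vb vs]; split=> [x xk | t tn].
  by rewrite /scale mulSn leq_add ?ub ?vb.
have /andP[u1 u2] := us t tn; have /andP[v1 v2] := vs t tn.
by rewrite psumD /scale !mulSn !leq_add.
Qed.

(* The prefix sums [s t] of [u] are cut into [s t %/ m.+1] and the rest;
   rounding prefix sums down keeps all the interval constraints. *)
Lemma is_base_split m b lo hi u :
  is_base (scale m.+1 b) (scale m.+1 lo) (scale m.+1 hi) u ->
  exists v w, [/\ is_base b lo hi v,
    is_base (scale m b) (scale m lo) (scale m hi) w &
    forall x, u x = v x + w x].
Proof.
move=> [ub us]; pose q := m.+1.
pose v x := psum u x.+1 %/ q - psum u x %/ q.
have mono x : psum u x %/ q <= psum u x.+1 %/ q.
  by apply: leq_div2r; rewrite psumS leq_addr.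
have incr x e : u x <= e * q -> v x <= e.
  move=> ue; rewrite /v leq_subLR addnC -divnMDl // psumS.
  by apply: leq_div2r; rewrite addnC leq_add2r.
have vu x : v x <= u x by apply: incr; rewrite leq_pmulr.
have pv t : psum v t = psum u t %/ q.
  elim: t => [|t IH]; first by rewrite !psum0 div0n.
  by rewrite psumS IH /v addnC subnK.
have pw t : psum (fun x => u x - v x) t = psum u t - psum u t %/ q.
  rewrite -pv; apply/eqP; rewrite -(eqn_add2r (psum v t)) subnK; last first.
    by apply: leq_sum.
  by rewrite -psumD; apply/eqP; apply: eq_bigr => x _; rewrite subnK.
exists v, (fun x => u x - v x); split; last by move=> x; rewrite addnC subnK.
- split=> [x xk | t tn]; first by apply: incr; rewrite mulnC; apply: ub.
  have /andP[h1 h2] := us t tn; rewrite /scale in h1 h2.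
  rewrite pv leq_divRL // mulnC h1 /= -(leq_pmul2l (ltn0Sn m)).
  by rewrite (leq_trans _ h2) // mulnC leq_divM.
split=> [x xk | t tn].
- have := ub x xk; rewrite /scale => uxb.
  case: (leqP (u x) (m * b x)) => [h | h]; first by apply: leq_trans (leq_subr _ _) h.
  (* The excess [e] of [u x] over [m * b x] is at most [b x], hence [e * m.+1 <= u x] and the
     quotient grows by at least [e]. *)
  have : u x - m * b x <= v x.
    rewrite /v leq_subRL // addnC -divnMDl // psumS.
    apply: leq_div2r; rewrite addnC leq_add2l.
    have eb : u x - m * b x <= b x by rewrite leq_subLR addnC -mulSn.
    rewrite mulnS -[leqRHS](subnK (ltnW h)) leq_add2l mulnC.
    by rewrite leq_mul2l eb orbT.
  lia.
have /andP[h1 h2] := us t tn; rewrite /scale in h1 h2 *.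
rewrite pw; move: h1 h2.
have := divn_eq (psum u t) q; have := ltn_pmod (psum u t) (ltn0Sn m).
rewrite -/q; move: (_ %/ q) (_ %% q) => a r rq ->; rewrite /q in rq *.
move=> h1 h2.
have la : lo t <= a by rewrite -ltnS -(ltn_pmul2l (ltn0Sn m)); nia.
have lom : m * lo t <= m * a by rewrite leq_mul2l la orbT.
have ar : a * m.+1 + r - a = m * a + r by rewrite mulnS mulnC; lia.
rewrite ar; apply/andP; split; first by lia.
(* Either [a = hi t] and the remainder [r] vanishes, or [a < hi t] and [r <= m] fits below
   [m * hi t]. *)
have [ah | ah] := leqP (hi t) a.
  have : m.+1 * hi t <= m.+1 * a by rewrite leq_mul2l ah orbT.
  have : m * hi t <= m * a by rewrite leq_mul2l ah orbT.
  rewrite mulSn in h2 *; rewrite mulnS mulnC in h2; nia.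
have : m * a.+1 <= m * hi t by rewrite leq_mul2l ah orbT.
rewrite mulnS; lia.
Qed.

(** * Gluing at tight positions and the lowest lattice point *)

Lemma is_base_glue b lo hi u v p : is_base b lo hi u -> is_base b lo hi v ->
  p <= n -> lo p = hi p -> is_base b lo hi (fun x => if x < p then u x else v x).
Proof.
move=> [ub us] [vb vs] pn tight; split=> [x xk | t tn].
  by case: ifP => _; [apply: ub | apply: vb].
have pre t' : t' <= p -> psum (fun x => if x < p then u x else v x) t' = psum u t'.
  move=> tp; apply: eq_big_nat => x /andP[_ xt].
  by rewrite (leq_trans xt tp).
have [/pre -> | pt] := leqP t p; first exact: us.
have -> : psum (fun x => if x < p then u x else v x) t = psum v t; last exact: vs.
have eqp : psum u p = psum v p by have := us p pn; have := vs p pn; lia.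
rewrite /psum !(@big_cat_nat _ _ _ p 0 t) ?(ltnW pt) //=.
rewrite -!/(psum _ p) pre // eqp; congr (_ + _).
by apply: eq_big_nat => x /andP[px _]; rewrite ltnNge px.
Qed.

Definition low_base lo x := lo x.+1 - lo x.

Lemma psum_low_base b lo hi t : PLP_bounds b lo hi -> t <= n ->
  psum (low_base lo) t = lo t.
Proof.
move=> H; elim: t => [|t IH] tn; first by rewrite psum0 (PLP_lo0 H).
rewrite psumS IH ?(ltnW tn) // /low_base subnKC //; exact: (PLP_lo H).
Qed.

Lemma is_base_low b lo hi : PLP_bounds b lo hi -> is_base b lo hi (low_base lo).
Proof.
move=> H; split=> [x xk | t tn]; first by rewrite /low_base (PLP_lo0 H).
by rewrite (psum_low_base H) // leqnn (PLP_lohi H).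
Qed.

(** Take for [y] the last variable of the next tight prefix. Moving a unit from [y] to [x] raises by
    one exactly the prefix sums of lengths [x.+1] to [y], none of which is tight. *)
Lemma low_base_socle b lo hi x : PLP_bounds b lo hi -> x < n -> lo x.+1 < hi x.+1 ->
  exists y, [/\ x < y < n, lo y.+1 = hi y.+1, 0 < low_base lo y &
    is_base b lo hi (fun z => low_base lo z + (z == x) - (z == y))].
Proof.
move=> H xn ntx.
have ex : exists y, (x < y) && (lo y.+1 == hi y.+1).
  exists n.-1; rewrite (ltn_predK xn) (PLP_last H) eqxx andbT.
  have : x.+1 != n by apply: contraTneq ntx => ->; rewrite (PLP_last H) ltnn.
  lia.
case: (ex_minnP ex) => y /andP[xy /eqP ty] ymin.
have yn : y < n.
  rewrite ltnNge; apply/negP => ny.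
  have := ymin n.-1; rewrite (ltn_predK xn) (PLP_last H) eqxx andbT.
  have : x.+1 != n by apply: contraTneq ntx => ->; rewrite (PLP_last H) ltnn.
  lia.
have nt t : x < t -> t <= y -> lo t < hi t.
  case: t => // t xt ty'; rewrite ltn_neqAle (PLP_lohi H) 1?andbT; last by lia.
  case: (eqVneq x t) => [<- | xt']; first by rewrite neq_ltn ntx.
  by apply/negP => tt; have := ymin t; rewrite tt andbT; lia.
have Ay : 0 < low_base lo y.
  rewrite /low_base subn_gt0 ty; apply: leq_trans (nt y xy (leqnn y)) _.
  exact: (PLP_hi H).
exists y; split=> //; first by rewrite xy.
split=> [z zk | t tn].
  rewrite /low_base (PLP_lo0 H) // sub0n add0n; have := PLP_b H zk; lia.
have -> : psum (fun z => low_base lo z + (z == x) - (z == y)) t =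
          lo t + (x < t) - (y < t).
  have eA s : s <= n ->
      psum (fun z => low_base lo z + (z == x) - (z == y)) s + (y < s) =
      lo s + (x < s).
    elim: s => [|s IH] sn; first by rewrite psum0 (PLP_lo0 H).
    rewrite psumS; have := IH (ltnW sn).
    have : lo s.+1 = lo s + low_base lo s.
      by rewrite /low_base subnKC //; apply: (PLP_lo H).
    case: (eqVneq s y) => [-> | sy]; first by lia.
    lia.
  by rewrite -eA // addnK.
case: (ltnP x t) => xt; last first.
  have -> : (y < t) = false by lia.
  by rewrite addn0 subn0 leqnn (PLP_lohi H).
case: (ltnP y t) => yt; first by rewrite addnK leqnn (PLP_lohi H).
by rewrite subn0 leq_addr addn1 nt.
Qed.

(** At the shortest prefix where [lo] reaches [lo n = hi n], the monotone [hi] cannot be larger. *)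
Lemma low_base_top b lo hi : PLP_bounds b lo hi ->
  exists y, [/\ y < n, lo y.+1 = hi y.+1 & 0 < low_base lo y].
Proof.
move=> H.
have ex : exists y, lo y.+1 == lo n.
  by exists n.-1; rewrite (ltn_predK (PLP_kn H)).
case: (ex_minnP ex) => y /eqP ey ymin.
have yn : y < n.
  by have := ymin n.-1; rewrite (ltn_predK (PLP_kn H)) eqxx => /(_ isT); have := PLP_kn H; lia.
exists y; split=> //.
  apply/eqP; rewrite eqn_leq (PLP_lohi H) // ey (PLP_last H).
  exact: (PLP_hi H).
rewrite /low_base subn_gt0 ltn_neqAle (PLP_lo H) // andbT.
case: y ey ymin yn => [|y] ey ymin yn.
  by rewrite (PLP_lo0 H) // ey neq_ltn (PLP_pos H).
by rewrite ey; apply/negP => e; have := ymin y e; rewrite ltnn.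
Qed.

End PrefixBounds.

Local Open Scope ring_scope.

(** * Ideals, adjoined elements and regular sequences *)

Section IdealTheory.
Variable R : comNzRingType.
Implicit Types (I J G : R -> Prop) (s : seq R).

Definition is_ideal J : Prop :=
  [/\ J 0, forall f g, J f -> J g -> J (f + g) & forall f g, J g -> J (f * g)].

Lemma ideal_sub J f g : is_ideal J -> J f -> J g -> J (f - g).
Proof.
by move=> [_ JD JM] Jf Jg; apply: JD => //; rewrite -mulN1r; apply: JM.
Qed.

Lemma ideal_subl J f g : is_ideal J -> J (f - g) -> J g -> J f.
Proof. by move=> [_ JD _] h Jg; rewrite -[f](subrK g); apply: JD. Qed.

Lemma ideal_subr J f g : is_ideal J -> J (f - g) -> J f -> J g.
Proof. by move=> HJ h Jf; rewrite -[g](subKr f); apply: ideal_sub. Qed.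

Lemma ideal_sum J (T : eqType) (r : seq T) (F : T -> R) : is_ideal J ->
  (forall x, x \in r -> J (F x)) -> J (\sum_(x <- r) F x).
Proof.
move=> [J0 JD JM] H; rewrite big_seq; elim/big_rec: _ => // x f /H Jx Jf.
exact: JD.
Qed.

Lemma ideal_gen_ideal G : is_ideal (ideal_gen G).
Proof.
split.
- by exists [::]; rewrite ?big_nil.
- move=> f g [c Gc ->] [c' Gc' ->]; exists (c ++ c'); last by rewrite big_cat.
  by move=> p; rewrite mem_cat => /orP[/Gc | /Gc'].
- move=> f g [c Gc ->]; exists [seq (f * p.1, p.2) | p <- c].
    by move=> p /mapP[q qc ->]; exact: (Gc q qc).
  by rewrite big_map mulr_sumr; apply: eq_bigr => p _; rewrite mulrA.
Qed.

Lemma mem_ideal_gen G g : G g -> ideal_gen G g.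
Proof.
move=> Gg; exists [:: (1, g)]; last by rewrite big_seq1 mul1r.
by move=> p; rewrite inE => /eqP ->.
Qed.

Lemma ideal_gen_least G J : is_ideal J -> (forall g, G g -> J g) ->
  forall f, ideal_gen G f -> J f.
Proof.
move=> HJ GJ f [c Gc ->]; apply: ideal_sum => // p /Gc /GJ.
by case: HJ => _ _; apply.
Qed.

Lemma ideal_adjoin_ideal J s : is_ideal (ideal_adjoin J s).
Proof. exact: ideal_gen_ideal. Qed.

Lemma ideal_adjoin_base J s f : J f -> ideal_adjoin J s f.
Proof. by move=> Jf; apply: mem_ideal_gen; left. Qed.

Lemma ideal_adjoin_mem J s f : f \in s -> ideal_adjoin J s f.
Proof. by move=> fs; apply: mem_ideal_gen; right. Qed.

Lemma ideal_adjoin_least J I s : is_ideal I -> (forall f, J f -> I f) ->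
  (forall f, f \in s -> I f) -> forall f, ideal_adjoin J s f -> I f.
Proof. by move=> HI JI sI; apply: ideal_gen_least => // g [/JI | /sI]. Qed.

Lemma ideal_adjoin_nil J f : is_ideal J -> ideal_adjoin J [::] f <-> J f.
Proof.
move=> HJ; split; last exact: ideal_adjoin_base.
by move: f; apply: ideal_adjoin_least.
Qed.

Lemma ideal_adjoin1 J y f : is_ideal J ->
  ideal_adjoin J [:: y] f <-> exists c, J (f - y * c).
Proof.
move=> HJ; have [J0 JD JM] := HJ; split=> [|[c Jc]].
  move: f; apply: ideal_adjoin_least.
  - split; first by exists 0; rewrite mulr0 subr0.
    + by move=> g h [c Jc] [c' Jc']; exists (c + c'); rewrite mulrDr opprD addrACA; apply: JD.
    + by move=> g h [c Jc]; exists (g * c); rewrite mulrCA -mulrBr; apply: JM.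
  - by move=> g Jg; exists 0; rewrite mulr0 subr0.
  - by move=> g; rewrite inE => /eqP ->; exists 1; rewrite mulr1 subrr.
apply: (ideal_subl (ideal_adjoin_ideal _ _)); first exact: ideal_adjoin_base Jc.
have [_ _ AM] := ideal_adjoin_ideal J [:: y].
by rewrite mulrC; apply/AM/ideal_adjoin_mem; rewrite inE.
Qed.

Lemma ideal_adjoin_cons J y s f :
  ideal_adjoin J (y :: s) f <-> ideal_adjoin (ideal_adjoin J [:: y]) s f.
Proof.
split; move: f; apply: ideal_adjoin_least; try exact: ideal_adjoin_ideal.
- by move=> g Jg; do 2!apply: ideal_adjoin_base.
- move=> g; rewrite inE => /orP[/eqP-> | gs]; last exact: ideal_adjoin_mem.
  by apply/ideal_adjoin_base/ideal_adjoin_mem; rewrite inE.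
- apply: ideal_adjoin_least; first exact: ideal_adjoin_ideal.
    by move=> g; apply: ideal_adjoin_base.
  by move=> g; rewrite inE => /eqP->; apply: ideal_adjoin_mem; rewrite inE eqxx.
- by move=> g gs; apply: ideal_adjoin_mem; rewrite inE gs orbT.
Qed.

Lemma regular_seq_cons M J y s : is_ideal J -> regular_seq M J (y :: s) ->
  [/\ M y, forall f, J (y * f) -> J f & regular_seq M (ideal_adjoin J [:: y]) s].
Proof.
move=> HJ [sM reg n1]; split; first by apply: sM; rewrite inE eqxx.
  by move=> f Jf; apply/(ideal_adjoin_nil _ HJ)/(reg 0%N) => //; apply/ideal_adjoin_nil.
split.
- by move=> f fs; apply: sM; rewrite inE fs orbT.
- move=> i f i_s /ideal_adjoin_cons h; apply/ideal_adjoin_cons.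
  exact: (reg i.+1).
- by move/ideal_adjoin_cons.
Qed.

(** * Koszul cohomology and grade *)

(* The cochain complex below is the Koszul complex of the family [x] without
   the alternating condition: degree [j] cochains are arbitrary functions on
   words of length [j].  Its cohomology on [R/J] still detects the grade, and
   no signs or exterior powers are needed. *)
Section Koszul.
Variables (T : Type) (x : T -> R).
Implicit Types (phi psi : seq T -> R).

Fixpoint koszul_d (w : seq T) phi : R :=
  if w is i :: w' then x i * phi w' - koszul_d w' (fun v => phi (i :: v)) else 0.

Lemma koszul_dB w phi psi :
  koszul_d w (fun v => phi v - psi v) = koszul_d w phi - koszul_d w psi.
Proof.
elim: w phi psi => [|i w IH] phi psi /=; first by rewrite subrr.
by rewrite IH mulrBr opprB addrACA [- _ + _]addrC opprB addrACA [_ - koszul_d _ _]addrC.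
Qed.

Lemma koszul_dM w c phi : koszul_d w (fun v => c * phi v) = c * koszul_d w phi.
Proof.
elim: w phi => [|i w IH] phi /=; first by rewrite mulr0.
by rewrite IH mulrBr mulrCA.
Qed.

Lemma koszul_dd w phi : koszul_d w (fun v => koszul_d v phi) = 0.
Proof.
elim: w phi => [|i w IH] phi //=.
by rewrite koszul_dB koszul_dM IH subr0 subrr.
Qed.

Lemma koszul_d_ideal J j phi : is_ideal J ->
  (forall w, size w = j -> J (phi w)) ->
  forall w, size w = j.+1 -> J (koszul_d w phi).
Proof.
move=> HJ; elim: j phi => [|j IH] phi Hphi [|i w] //= [sw]; apply: ideal_sub => //.
- by case: HJ => _ _; apply; apply: Hphi.
- by rewrite (size0nil sw) /=; case: HJ.
- by case: HJ => _ _; apply; apply: Hphi.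
- by apply: IH => // v sv; apply: Hphi; rewrite /= sv.
Qed.

Definition koszul_cocycle J j phi : Prop :=
  forall w, size w = j.+1 -> J (koszul_d w phi).

Definition koszul_coboundary J j phi : Prop :=
  exists psi, forall w, size w = j -> J (phi w - koszul_d w psi).

Definition koszul_acyclic J j : Prop :=
  forall phi, koszul_cocycle J j phi -> koszul_coboundary J j phi.

Definition span_ideal : R -> Prop := ideal_gen (fun g => exists i, g = x i).

(** Contraction with the letter [i] is a homotopy for multiplication by [x i]: the recursion
    defining [koszul_d] at [i :: w] says exactly this. *)
Lemma koszul_annihilated J j phi y : is_ideal J -> koszul_cocycle J j phi ->
  span_ideal y -> koszul_coboundary J j (fun w => y * phi w).
Proof.
move=> HJ cphi; have [J0 JD JM] := HJ; move: y; apply: ideal_gen_least.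
  split.
  - exists (fun v => 0 * phi v) => w _.
    by rewrite koszul_dM !mul0r subr0.
  - move=> f g [psi Hf] [psi' Hg]; exists (fun w => psi w - - 1 * psi' w) => w sw.
    rewrite koszul_dB koszul_dM mulN1r opprK mulrDl opprD addrACA.
    by apply: JD; [apply: Hf | apply: Hg].
  - move=> f g [psi Hg]; exists (fun w => f * psi w) => w sw.
    by rewrite koszul_dM -mulrA -mulrBr; apply: JM; apply: Hg.
move=> _ [i ->]; exists (fun w => phi (i :: w)) => w sw.
by apply: (cphi (i :: w)); rewrite /= sw.
Qed.

(** Induction on [s]. Modulo [J], [y * phi] is some [d psi]; modulo [y] as well, [psi] is a cocycle,
    so [psi = d theta + y * chi]. Applying [d] and cancelling [y] gives [phi = d chi]. *)
Lemma regular_seq_acyclic J s j : is_ideal J -> regular_seq span_ideal J s ->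
  (j < size s)%N -> koszul_acyclic J j.
Proof.
elim: s J j => [|y s IH] J j // HJ /(regular_seq_cons HJ)[My regy regs] js phi cphi.
have [psi Hpsi] := koszul_annihilated HJ cphi My.
case: j js cphi Hpsi => [|j] js cphi Hpsi.
  exists psi => w sw; have := Hpsi w sw; rewrite (size0nil sw) /= !subr0.
  exact: regy.
have HJ' := ideal_adjoin_ideal J [:: y].
have [|theta Htheta] := IH _ j HJ' regs js psi.
  move=> w sw; apply: (ideal_subr HJ'); first exact/ideal_adjoin_base/(Hpsi w sw).
  case: HJ' => _ _ AM; rewrite mulrC; apply/AM/ideal_adjoin_mem.
  by rewrite inE.
have [chi Hchi] : exists chi, forall w, size w = j ->
    J (psi w - koszul_d w theta - y * chi w).
  have [|chi Hchi] := functional_choice (fun w c => size w = j ->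
      J (psi w - koszul_d w theta - y * c)).
    move=> w; case: (eqVneq (size w) j) => [sw | nsw].
      by have /(ideal_adjoin1 _ _ HJ)[c Hc] := Htheta w sw; exists c.
    by exists 0 => sw; rewrite sw eqxx in nsw.
  by exists chi.
exists chi => w sw; apply: regy.
have := koszul_d_ideal HJ Hchi sw.
rewrite !koszul_dB koszul_dd subr0 koszul_dM => h.
rewrite mulrBr -(subrK (koszul_d w psi) (y * phi w)) -addrA.
by case: HJ => _ JD _; apply: JD => //; apply: Hpsi.
Qed.

(** Acyclicity in degrees [size s] and one more descends modulo the first element [y] to degree
    [size s]. When the sequence is exhausted, the socle element [u] is a nonzero class of degree
    0. *)
Lemma socle_not_acyclic J s u : is_ideal J -> regular_seq span_ideal J s ->
  ~ ideal_adjoin J s u -> (forall i, ideal_adjoin J s (x i * u)) ->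
  ~ koszul_acyclic J (size s).
Proof.
elim: s J => [|y s IH] J HJ regJ nu xu acyc.
  apply: nu; apply/ideal_adjoin_nil => //.
  have [|psi /(_ [::] erefl)] := acyc (fun=> u); last by rewrite subr0.
  by case=> [|i [|]] //= _; rewrite subr0; apply/(ideal_adjoin_nil _ HJ).
have acyc0 : koszul_acyclic J (size s) by apply: (regular_seq_acyclic HJ regJ) => /=.
have [My regy regs] := regular_seq_cons HJ regJ.
have HJ' := ideal_adjoin_ideal J [:: y].
apply: (IH _ HJ' regs).
- by move/ideal_adjoin_cons.
- by move=> i; apply/ideal_adjoin_cons.
move=> psi cpsi.
have [phi Hphi] : exists phi, forall w, size w = (size s).+1 ->
    J (koszul_d w psi - y * phi w).
  have [|phi Hphi] := functional_choice (fun w c => size w = (size s).+1 ->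
      J (koszul_d w psi - y * c)).
    move=> w; case: (eqVneq (size w) (size s).+1) => [sw | nsw].
      by have /(ideal_adjoin1 _ _ HJ)[c Hc] := cpsi w sw; exists c.
    by exists 0 => sw; rewrite sw eqxx in nsw.
  by exists phi.
have [|chi Hchi] := acyc phi.
  move=> w sw; apply: regy; have := koszul_d_ideal HJ Hphi sw.
  rewrite koszul_dB koszul_dd koszul_dM sub0r => h.
  by rewrite -[_ * _]opprK -mulN1r; case: HJ => _ _; apply.
have [|theta Htheta] := acyc0 (fun w => psi w - y * chi w).
  move=> w sw; rewrite koszul_dB koszul_dM.
  have [_ JD JM] := HJ.
  rewrite -(subrK (y * phi w) (koszul_d w psi)) -addrA -mulrBr.
  by apply: JD; [apply: Hphi | apply/JM/Hchi].
exists theta => w sw; apply/ideal_adjoin1 => //; exists (chi w).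
by rewrite addrAC; apply: Htheta.
Qed.

Lemma has_grade_socle J s u : is_ideal J -> regular_seq span_ideal J s ->
  ~ ideal_adjoin J s u -> (forall i, ideal_adjoin J s (x i * u)) ->
  has_grade span_ideal J (size s).
Proof.
move=> HJ regJ nu xu; split; first by exists s.
move=> t regt; rewrite leqNgt; apply/negP => st.
exact: (socle_not_acyclic HJ regJ nu xu (regular_seq_acyclic HJ regt st)).
Qed.

End Koszul.
End IdealTheory.

(** * Monomial ideals and differences of variables *)

Section MonomialIdeals.
Variables (K : fieldType) (n : nat).
Implicit Types (D E : 'X_{1..n} -> Prop) (f g : {mpoly K[n]}).

Definition mon_ideal D : {mpoly K[n]} -> Prop :=
  ideal_gen (fun g => exists2 u, D u & g = 'X_[u]).

Definition above D m : Prop := exists2 u, D u & (u <= m)%MM.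

Lemma above_le D u v : (u <= v)%MM -> above D u -> above D v.
Proof. by move=> uv [w Dw wu]; exists w => //; apply: lepm_trans wu uv. Qed.

Lemma mon_ideal_ideal D : is_ideal (mon_ideal D).
Proof. exact: ideal_gen_ideal. Qed.

Lemma mem_mon_ideal D f :
  mon_ideal D f <-> forall m, m \in msupp f -> above D m.
Proof.
split=> [|H].
  move: f; apply: ideal_gen_least.
    split=> [m | f g Hf Hg m /msuppD_le | f g Hg m /msuppM_le].
    - by rewrite msupp0.
    - by rewrite mem_cat => /orP[/Hf | /Hg].
    - case/allpairsP=> [[u v] /= [uf /Hg Ev ->]].
      by apply: above_le Ev; apply: lem_addl.
  move=> _ [u Du ->] m; rewrite msuppX inE => /eqP ->.
  by exists u => //; apply: lepm_refl.
rewrite [f]mpolyE; apply: ideal_sum => [|m mf]; first exact: mon_ideal_ideal.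
have [u Du um] := H m mf; have [_ _ IM] := mon_ideal_ideal D.
rewrite -(submK um) mpolyXD scalerAl; apply: IM.
by apply: mem_ideal_gen; exists u.
Qed.

Lemma mon_idealX D m : mon_ideal D 'X_[m] <-> above D m.
Proof.
rewrite mem_mon_ideal; split=> [H | Em m'].
  by apply: H; rewrite msuppX inE.
by rewrite msuppX inE => /eqP ->.
Qed.

Lemma mon_idealMX D g a :
  mon_ideal D (g * 'X_[a]) <-> forall m, m \in msupp g -> above D (m + a)%MM.
Proof.
rewrite mem_mon_ideal; split=> H m mg.
  by apply: H; rewrite (perm_mem (msuppMX _ _)) addmC; apply: map_f.
move: mg; rewrite (perm_mem (msuppMX _ _)) => /mapP[m' m'g ->].
by rewrite addmC; apply: H.
Qed.

Lemma msuppMU g m i : m \in msupp (g * 'X_i) -> (0 < m i)%N.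
Proof.
rewrite (perm_mem (msuppMX _ _)) => /mapP[m' _ ->].
by rewrite mnmDE mnm1E eqxx.
Qed.

Lemma mcoeffMXr g m v : (g * 'X_[m])@_(v + m) = g@_v.
Proof. by rewrite addmC mcoeffMX. Qed.

(* A monomial [v] outside [E] stays outside along the whole ray in direction
   [p] or along the whole ray in direction [q]; in the second case, comparing
   coefficients at [v + q] moves it to [v + q - p], lowering its [p]-degree. *)
Lemma mon_ideal_regular_diff E (p q : 'I_n) g : p != q ->
  (forall u v, (u <= v)%MM -> E u -> E v) ->
  (forall v N N', E (v + U_(p) *+ N)%MM -> E (v + U_(q) *+ N')%MM -> E v) ->
  (forall m, m \in msupp (('X_p - 'X_q) * g) -> E m) ->
  forall m, m \in msupp g -> E m.
Proof.
move=> pq0 upE rays.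
have ray (p' q' : 'I_n) : p' != q' -> (forall m, m \in msupp (('X_p' - 'X_q') * g) -> E m) ->
    forall N (v : 'X_{1..n}), v p' = N ->
    (forall N', ~ E (v + U_(q') *+ N')%MM) -> v \in msupp g -> False.
  move=> pq H; elim=> [|N IH] v vN nE vg.
  - have : (v + U_(q'))%MM \in msupp (('X_p' - 'X_q') * g).
      rewrite mcoeff_msupp mulrC mulrBr mcoeffB mcoeffMXr.
      rewrite [X in X - _]memN_msupp_eq0 ?sub0r ?oppr_eq0 -?mcoeff_msupp //.
      apply/negP => /msuppMU; rewrite mnmDE vN mnm1E.
      by rewrite eq_sym (negbTE pq).
    by move/H; apply: (nE 1%N).
  - pose v' := (v + U_(q') - U_(p'))%MM.
    have ev : (v + U_(q') = v' + U_(p'))%MM.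
      by rewrite submK // lep1mP mnmDE vN.
    apply: (IH v').
    + by rewrite mnmBE mnmDE vN !mnm1E eqxx eq_sym (negbTE pq) addn0 subn1.
    + move=> N' h; apply: (nE N'.+1); apply: upE h.
      by rewrite mulmS addmA ev -addmA [(U_(p') + _)%MM]addmC addmA lem_addr.
    + apply: contraT => nv'; case: (nE 1%N); apply: H.
      rewrite mulm1n mcoeff_msupp mulrC mulrBr mcoeffB mcoeffMXr ev mcoeffMXr.
      by rewrite (memN_msupp_eq0 nv') sub0r oppr_eq0 -mcoeff_msupp.
move=> H m mg; apply: NNPP => nEm.
have [allq | ] := classic (forall N', ~ E (m + U_(q) *+ N')%MM).
  exact: (ray p q pq0 H _ m erefl allq mg).
move/not_all_not_ex => [N' EN'].
apply: (ray q p _ _ _ m erefl _ mg); first by rewrite eq_sym.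
  by move=> m'; rewrite -opprB mulNr (perm_mem (msuppN _)); apply: H.
by move=> N EN; apply: nEm; apply: rays EN EN'.
Qed.

(** * Identification of variables *)

Section Substitution.
Variable sigma : 'I_n -> 'I_n.

Definition mon_push (m : 'X_{1..n}) : 'X_{1..n} := (\sum_i U_(sigma i) *+ m i)%MM.

Definition var_subst f : {mpoly K[n]} := f \mPo [tuple 'X_(sigma i) | i < n].

HB.instance Definition _ := GRing.RMorphism.copy var_subst
  (comp_mpoly [tuple 'X_(sigma i) : {mpoly K[n]} | i < n]).

Lemma var_substX m : var_subst 'X_[m] = 'X_[mon_push m].
Proof.
rewrite /var_subst comp_mpolyX /mon_push -mprodXnE.
by apply: eq_bigr => i _; rewrite tnth_mktuple.
Qed.

Lemma var_substXU i : var_subst 'X_i = 'X_(sigma i).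
Proof. by rewrite /var_subst comp_mpolyXU -tnth_nth tnth_mktuple. Qed.

Lemma var_substZ c f : var_subst (c *: f) = c *: var_subst f.
Proof. exact: comp_mpolyZ. Qed.

Lemma mon_pushE m j : mon_push m j = (\sum_(i | sigma i == j) m i)%N.
Proof.
rewrite mnm_sumE [RHS]big_mkcond; apply: eq_bigr => i _.
by rewrite mulmnE mnm1E; case: eqP => _; rewrite ?mul1n.
Qed.

Lemma mdeg_mon_push m : mdeg (mon_push m) = mdeg m.
Proof.
rewrite mdeg_sum mdegE; apply: eq_bigr => i _.
by rewrite mdegMn mdeg1 mul1n.
Qed.

Lemma sub_var_subst (L : {mpoly K[n]} -> Prop) : is_ideal L ->
  (forall i, L ('X_i - 'X_(sigma i))) -> forall f, L (f - var_subst f).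
Proof.
move=> HL Lx f; have [L0 LD LM] := HL.
rewrite {1}[f]mpolyE [in X in _ - X](mpolyE f) rmorph_sum -sumrB.
apply: ideal_sum => // m _; rewrite /= var_substZ -scalerBr -mul_mpolyC; apply: (LM).
have LMx f1 f2 : L (f1 - var_subst f1) -> L (f2 - var_subst f2) ->
    L (f1 * f2 - var_subst (f1 * f2)).
  move=> h1 h2; rewrite rmorphM /=.
  have -> : f1 * f2 - var_subst f1 * var_subst f2 =
    f1 * (f2 - var_subst f2) + var_subst f2 * (f1 - var_subst f1).
    move: (var_subst f1) (var_subst f2) => a b.
    by rewrite !mulrBr [b * f1]mulrC addrA subrK [b * a]mulrC.
  by apply: LD; apply: LM.
have L1 : L (1 - var_subst 1) by rewrite rmorph1 subrr.
rewrite mpolyXE_id; elim/big_rec: _ => [|i g _ Lg]; first exact: L1.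
apply: (LMx) Lg; elim: (m i) => [|e IH]; first exact: L1.
by rewrite exprS; apply: LMx IH; rewrite var_substXU.
Qed.

Lemma mon_ideal_subst D f : mon_ideal D f ->
  mon_ideal (fun m => exists2 u, D u & m = mon_push u) (var_subst f).
Proof.
move: f; apply: ideal_gen_least; last first.
  by move=> _ [u Du ->]; rewrite var_substX; apply: mem_ideal_gen;
    exists (mon_push u) => //; exists u.
have [J0 JD JM] := mon_ideal_ideal (fun m => exists2 u, D u & m = mon_push u).
split=> [| f g Jf Jg | f g Jg]; first by rewrite rmorph0; apply: J0.
  by rewrite rmorphD; apply: JD.
by rewrite rmorphM; apply: JM.
Qed.

End Substitution.

Definition merge_var (p0 : 'I_n) (s : seq 'I_n) i := if i \in s then p0 else i.

(** Adjoining the differences identifies the variables of [s] with [p0]; the quotient becomes one by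
    a monomial ideal, where membership is tested on monomials. *)
Lemma ideal_adjoin_merge D p0 s f :
  ideal_adjoin (mon_ideal D) [seq 'X_p0 - 'X_p | p <- s] f <->
  mon_ideal (fun m => exists2 u, D u & m = mon_push (merge_var p0 s) u)
    (var_subst (merge_var p0 s) f).
Proof.
pose J := mon_ideal (fun m => exists2 u, D u & m = mon_push (merge_var p0 s) u).
have HJ : is_ideal J := mon_ideal_ideal _.
rewrite -/J.
have [J0 JD JM] := HJ.
set L := ideal_adjoin _ _; have HL : is_ideal L := ideal_adjoin_ideal _ _.
have Lsub g : L (g - var_subst (merge_var p0 s) g).
  apply: sub_var_subst => // i; rewrite /merge_var.
  case: ifP => [si | _]; last by rewrite subrr; case: HL.
  rewrite -opprB -mulN1r; case: HL => _ _; apply; apply: ideal_adjoin_mem.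
  exact: (map_f (fun p => 'X_p0 - 'X_p)).
split=> [| Jf].
  move: f; apply: ideal_adjoin_least.
  - split=> [| f g Jf Jg | f g Jg]; first by rewrite rmorph0; apply: J0.
      by rewrite rmorphD; apply: JD.
    by rewrite rmorphM; apply: JM.
  - exact: mon_ideal_subst.
  - move=> _ /mapP[p ps ->]; rewrite rmorphB /= !var_substXU /merge_var ps.
    by case: ifP => _; rewrite subrr; apply: J0.
apply: (ideal_subl HL (Lsub f)).
move: (var_subst _ _) Jf; apply: ideal_gen_least => // _ [_ [u Du ->] ->].
rewrite -var_substX; apply: (ideal_subr HL (Lsub _)).
by apply/ideal_adjoin_base/mem_ideal_gen; exists u.
Qed.

End MonomialIdeals.

Arguments mon_ideal K {n} D _.

(** * Base monomials and the depth of their ideal *)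

Section BaseMonomials.
Variables (K : fieldType) (n k : nat).
Implicit Types (b lo hi : nat -> nat).

Definition mon_fun (f : 'I_n -> nat) (x : nat) : nat :=
  if insub x is Some i then f i else 0%N.

Lemma mon_funE f (i : 'I_n) : mon_fun f i = f i.
Proof. by rewrite /mon_fun valK. Qed.

Lemma mon_fun_lt f x (xn : (x < n)%N) : mon_fun f x = f (Ordinal xn).
Proof. by rewrite -mon_funE. Qed.

Lemma mon_fun_multinom (u : nat -> nat) x : (x < n)%N ->
  mon_fun [multinom u i | i < n] x = u x.
Proof. by move=> xn; rewrite (mon_fun_lt _ xn) mnmE. Qed.

Lemma psum_mon_fun f t : (t <= n)%N ->
  psum (mon_fun f) t = (\sum_(i < n | (i < t)%N) f i)%N.
Proof.
move=> tn; rewrite /psum big_mkord (big_ord_widen n (mon_fun f) tn).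
by apply: eq_bigr => i _; rewrite mon_funE.
Qed.

Lemma eq_is_base b lo hi u v : (k <= n)%N ->
  (forall x, (x < n)%N -> u x = v x) ->
  is_base n k b lo hi u -> is_base n k b lo hi v.
Proof.
move=> kn uv [ub us]; split=> [x xk | t tn].
  by rewrite -uv ?ub // (leq_trans xk).
rewrite -(_ : psum u t = psum v t) ?us //.
by apply: eq_big_nat => x /andP[_ xt]; rewrite uv // (leq_trans xt).
Qed.

Lemma eq_feasible b lo hi u v : (forall x, (x < n)%N -> u x = v x) ->
  feasible n k b lo hi u -> feasible n k b lo hi v.
Proof.
by move=> uv [w wb wu]; exists w => // x xn; rewrite -uv // wu.
Qed.

Definition base_mon b lo hi (u : 'X_{1..n}) : Prop :=
  is_base n k b lo hi (mon_fun u).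

Lemma base_mon_multinom b lo hi (u : nat -> nat) : (k <= n)%N -> is_base n k b lo hi u ->
  base_mon b lo hi [multinom u i | i < n].
Proof. by move=> kn; apply: eq_is_base => // x xn; rewrite mon_fun_multinom. Qed.

Lemma above_feasible b lo hi m : (k <= n)%N ->
  above (base_mon b lo hi) m <-> feasible n k b lo hi (mon_fun m).
Proof.
move=> kn; split=> [[u ub /mnm_lepP um] | [u ub um]].
  by exists (mon_fun u) => // x xn; rewrite !(mon_fun_lt _ xn) um.
exists [multinom u i | i < n]; first exact: base_mon_multinom.
by apply/mnm_lepP => i; rewrite mnmE -(mon_funE m) um.
Qed.

Definition tight_vars lo hi : seq 'I_n :=
  [seq i : 'I_n <- enum 'I_n | lo i.+1 == hi i.+1].

Lemma mem_tight_vars lo hi (i : 'I_n) :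
  (i \in tight_vars lo hi) = (lo i.+1 == hi i.+1).
Proof. by rewrite mem_filter mem_enum andbT. Qed.

Lemma tight_vars_pairwise lo hi :
  pairwise (fun i j : 'I_n => (i < j)%N) (tight_vars lo hi).
Proof.
apply: pairwise_filter; rewrite -(pairwise_map val ltn) val_enum_ord.
by rewrite -sorted_pairwise ?iota_ltn_sorted //; apply: ltn_trans.
Qed.

Section Depth.
Variables (b lo hi : nat -> nat).
Hypothesis bounds : PLP_bounds n k b lo hi.
Let D := base_mon b lo hi.

Let kn : (k <= n)%N. Proof. exact: ltnW (PLP_kn bounds). Qed.

(* If both rays are eventually in the ideal, glueing the two exponents at the tight
   position before [q] gives one witnessing that [v] itself is. *)
Lemma merge_rays p0 (s : seq 'I_n) q N N' v :
  pairwise (fun i j : 'I_n => (i < j)%N) (rcons (p0 :: s) q) ->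
  (forall i, i \in p0 :: s -> lo i.+1 = hi i.+1) ->
  let E := above (fun m => exists2 u, D u & m = mon_push (merge_var p0 s) u) in
  E (v + U_(p0) *+ N)%MM -> E (v + U_(q) *+ N')%MM -> E v.
Proof.
rewrite pairwise_rcons => /andP[/allP ltq pw] tight E.
pose P := last p0 s.
have PS : P \in p0 :: s by apply: mem_last.
have leP i : i \in p0 :: s -> (i <= P)%N.
  move: pw; rewrite lastI pairwise_rcons -/P => /andP[/allP h _].
  by rewrite mem_rcons inE => /orP[/eqP-> // | /h /ltnW].
have Pq : (P < q)%N by apply: ltq.
move=> [_ [u1 D1 ->] /mnm_lepP le1] [_ [u2 D2 ->] /mnm_lepP le2].
have Dg := is_base_glue D2 D1 (ltn_ord P) (tight P PS).
have := base_mon_multinom kn Dg; set u := [multinom _ | i < n] => Du.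
have uE i : u i = if (i <= P)%N then u2 i else u1 i.
  by rewrite mnmE !mon_funE.
exists (mon_push (merge_var p0 s) u); first by exists u.
apply/mnm_lepP => j; rewrite mon_pushE.
(* All merged positions are at most [P], so at [p0] only [u2] counts, and its ray leaves that
   coordinate of [v] alone. At [q], beyond [P], only [u1] counts, whose ray moves [p0]. *)
have [-> | jp0] := eqVneq j p0.
  have := le2 p0; rewrite mon_pushE mnmDE mulmnE mnm1E.
  have -> : q == p0 = false.
    by apply/negbTE; rewrite -val_eqE neq_ltn ltq ?orbT // inE eqxx.
  rewrite mul0n addn0; apply: leq_trans; rewrite leq_eqVlt; apply/orP; left.
  apply/eqP; apply: eq_bigr => i; rewrite uE /merge_var.
  have [si _ | _ /eqP ->] := boolP (i \in s).
    by rewrite leP // inE si orbT.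
  by rewrite leP // inE eqxx.
have [js | njs] := boolP (j \in s).
  rewrite big1 // => i; rewrite /merge_var; case: ifP => [_ | nis /eqP e].
    by rewrite eq_sym (negbTE jp0).
  by rewrite e js in nis.
have mergeE i : (merge_var p0 s i == j) = (i == j).
  rewrite /merge_var; case: ifP => // is_; rewrite eq_sym (negbTE jp0).
  by apply/esym/negbTE; apply: contraNneq njs => <-.
have e w : (mon_push (merge_var p0 s) w) j = w j.
  by rewrite mon_pushE (eq_bigl _ _ mergeE) big_pred1_eq.
rewrite (eq_bigl _ _ mergeE) big_pred1_eq uE.
have := le1 j; have := le2 j; rewrite !e !mnmDE !mulmnE !mnm1E.
rewrite [p0 == j]eq_sym (negbTE jp0) mul0n addn0.
have [<- _ | _] := eqVneq q j; last by rewrite mul0n addn0; case: ifP.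
by rewrite (leqNgt q P) Pq.
Qed.

Lemma mdeg_base u : D u -> mdeg u = lo n.
Proof.
move=> [_ /(_ n (leqnn n))]; rewrite psum_mon_fun // (PLP_last bounds).
rewrite -eqn_leq => /eqP ->; rewrite mdegE.
by apply: eq_bigl => i; rewrite ltn_ord.
Qed.

Lemma base_mon_depth :
  has_depth (mon_ideal K D) (size (tight_vars lo hi)).-1.
Proof.
have [y0 [y0n ty0 Ay0]] := low_base_top bounds.
pose yt := Ordinal y0n.
have ytT : yt \in tight_vars lo hi by rewrite mem_tight_vars; apply/eqP.
case ET : (tight_vars lo hi) ytT => [// | p0 ps] ytT /=.
have memT i : (i \in p0 :: ps) = (lo i.+1 == hi i.+1).
  by rewrite -ET mem_tight_vars.
have pwT : pairwise (fun i j : 'I_n => (i < j)%N) (p0 :: ps).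
  by rewrite -ET tight_vars_pairwise.
pose z := [seq 'X_p0 - 'X_p : {mpoly K[n]} | p <- ps].
have -> : size ps = size z by rewrite size_map.
pose sg := merge_var p0 ps; pose phi := @var_subst K n sg.
have phiM f g : phi (f * g) = phi f * phi g by apply: rmorphM.
pose J := mon_ideal K (fun m => exists2 u, D u & m = mon_push sg u).
have sgT i : i \in p0 :: ps -> sg i = p0.
  by rewrite /sg /merge_var inE; case: ifP => // _; rewrite orbF => /eqP.
have LJ f : ideal_adjoin (mon_ideal K D) z f <-> J (phi f).
  exact: ideal_adjoin_merge.
have JX u : D u -> J (phi 'X_[u]).
  by move=> Du; rewrite /phi var_substX; apply/mon_idealX; exists (mon_push sg u);
    [exists u | apply: lepm_refl].
have DA : D [multinom low_base lo i | i < n].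
  by apply: base_mon_multinom => //; apply: is_base_low bounds.
set A := [multinom _ | i < n] in DA.
pose U := (A - U_(yt))%MM.
have AE i : A i = low_base lo i by rewrite mnmE.
have UA (y : 'I_n) : (0 < low_base lo y)%N -> (A - U_(y) + U_(y))%MM = A.
  by move=> Ay; apply: submK; rewrite lep1mP AE -lt0n.
(* After merging, dividing [x^A] by any tight variable amounts to dividing its image by ['X_p0]. *)
have phi_eq (y : 'I_n) : y \in p0 :: ps -> (0 < low_base lo y)%N ->
    phi 'X_[U] = phi 'X_[A - U_(y)].
  move=> yT Ay; apply: (@mulfI _ 'X_p0).
    by rewrite -msize_poly_eq0 msizeX.
  have h (w : 'I_n) : w \in p0 :: ps -> (0 < low_base lo w)%N ->
      'X_p0 * phi 'X_[A - U_(w)] = phi 'X_[A].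
    move=> wT Aw; rewrite -[in RHS](UA w Aw) mpolyXD phiM.
    by rewrite /phi (var_substXU _ _ w) sgT // mulrC.
  by rewrite !h.
(* Merging preserves degrees, and [U] has degree one less than the generators. *)
have nU : ~ ideal_adjoin (mon_ideal K D) z 'X_[U].
  rewrite LJ /phi var_substX /J mon_idealX => [[_ [u Du ->] /mnm_lepP le_uU]].
  have : (mdeg u <= mdeg U)%N.
    rewrite -(mdeg_mon_push sg u) -(mdeg_mon_push sg U) !mdegE.
    exact: leq_sum.
  have := congr1 (@mdeg n) (UA yt Ay0); rewrite mdegD mdeg1 -/U.
  rewrite (mdeg_base Du) (mdeg_base DA); lia.
apply: (@has_grade_socle _ _ _ _ z 'X_[U]) => //; first exact: mon_ideal_ideal.
- split; last first.
  + move=> L1; apply: nU; have [_ _ LM] := ideal_adjoin_ideal (mon_ideal K D) z.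
    by rewrite -['X_[U]]mulr1; apply: LM.
  + move=> i f; rewrite size_map => ips; rewrite -map_take.
    rewrite (nth_map p0) //; set q := nth p0 ps i => /ideal_adjoin_merge.
    have Tsplit : p0 :: ps = rcons (p0 :: take i ps) q ++ drop i.+1 ps.
      by rewrite cat_rcons -drop_nth //= cat_take_drop.
    have := pwT; rewrite Tsplit pairwise_cat => /and3P[_ pwq _].
    have qlt x : x \in p0 :: take i ps -> (x < q)%N.
      by move: pwq; rewrite pairwise_rcons => /andP[/allP h _]; apply: h.
    have qs : q \notin take i ps.
      by apply/negP => h; have := qlt q; rewrite inE h orbT ltnn => /(_ isT).
    have p0q : p0 != q.
      by rewrite -val_eqE neq_ltn qlt // inE eqxx.
    rewrite rmorphM rmorphB /= !var_substXU /merge_var (negbTE qs) if_same -/(merge_var _ _).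
    move/mem_mon_ideal => Hf; apply/ideal_adjoin_merge/mem_mon_ideal.
    apply: (mon_ideal_regular_diff p0q) Hf.
      by move=> u v; apply: above_le.
    move=> v N N'; apply: merge_rays => // x xs; apply/eqP.
    by rewrite -memT Tsplit mem_cat mem_rcons inE xs orbT.
  + move=> _ /mapP[p _ ->].
    have HM : is_ideal (span_ideal (fun i : 'I_n => 'X_i : {mpoly K[n]})).
      exact: ideal_gen_ideal.
    by apply: ideal_sub => //; apply: mem_ideal_gen; [exists p0 | exists p].
- move=> x; apply/LJ.
  have [xT | nxT] := boolP (x \in p0 :: ps).
    suff -> : phi ('X_x * 'X_[U]) = phi 'X_[A] by apply: JX.
    rewrite -[in RHS](UA yt Ay0) mpolyXD !phiM mulrC; congr (_ * _).
    by rewrite /phi !var_substXU !sgT.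
  have ntx : (lo x.+1 < hi x.+1)%N.
    by rewrite ltn_neqAle -memT nxT (PLP_lohi bounds).
  have [y [/andP[xy yn] ty Ay base_xy]] := low_base_socle bounds (ltn_ord x) ntx.
  pose y' := Ordinal yn.
  have yT : y' \in p0 :: ps by rewrite memT; apply/eqP.
  (* For a variable [x] that is not tight, [U] is traded for [A - y] with the [y] adapted to [x];
     then [x * x^A / x_y] is a generator. *)
  rewrite phiM (phi_eq y' yT Ay) -phiM -mpolyXD; apply: JX.
  have -> : (U_(x) + (A - U_(y')))%MM =
      [multinom low_base lo i + (nat_of_ord i == x) - (nat_of_ord i == y) | i < n].
    apply/mnmP => i; rewrite mnmDE mnmBE !mnm1E AE mnmE -!val_eqE /=.
    rewrite [val x == val i]eq_sym [y == val i]eq_sym addnC.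
    case: (eqVneq (val i) y) => [e | _]; last by rewrite !subn0.
    by move: Ay; rewrite -e /=; case: (_ == _); lia.
  exact: (base_mon_multinom kn base_xy).
Qed.

End Depth.
End BaseMonomials.

(** * Associated primes of monomial ideals *)

Section AssociatedPrimes.
Variables (K : fieldType) (n : nat).
Implicit Types (D : 'X_{1..n} -> Prop) (P : {mpoly K[n]} -> Prop).

Lemma msupp_subC f m : m \in msupp f ->
  size (msupp (f - f@_m *: 'X_[m] : {mpoly K[n]})) = (size (msupp f)).-1.
Proof. by move=> mf; rewrite (perm_size (msupp_rem _ _)) size_rem. Qed.

Lemma prime_monomial P m : prime_ideal P ->
  P 'X_[m] <-> exists i, P 'X_i /\ (0 < m i)%N.
Proof.
move=> [P0 PD PM P1 Pp]; split; last first.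
  move=> [i [Pi mi]]; have im : (U_(i) <= m)%MM by rewrite lep1mP -lt0n.
  by rewrite -(submK im) mpolyXD; apply: PM.
rewrite mpolyXE_id; elim: (index_enum _) => [|i r IH]; first by rewrite big_nil.
rewrite big_cons => /Pp[] // {IH} Pi; exists i.
elim: (m i) Pi => [|e IH]; first by rewrite expr0.
by rewrite exprS => /Pp[Pi // | /IH []].
Qed.

(* Take [f] with as few terms as possible among the [f] with [P = (J : f)].
   No term of [f] lies in [J]; if [P] were not a monomial ideal, multiplying [f]
   by the leading monomial of a suitable [g] in [P] would create such a term. *)
Lemma Ass_mon_ideal D P : Ass (mon_ideal K D) P ->
  exists a, forall g, P g <-> mon_ideal K D (g * 'X_[a]).
Proof.
move=> [[P0 PD PM P1 Pp] [f]]; set J := mon_ideal K D.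
have HJ : is_ideal J := mon_ideal_ideal _ _; have [J0 JD JM] := HJ.
have HP : is_ideal P by split.
move: {2}(size (msupp f)) (leqnn (size (msupp f))) => N.
elim: N f => [|N IH] f szf Pf.
  have f0 : f = 0 by apply: msuppnil0; apply: size0nil; lia.
  by case: P1; apply/Pf; rewrite f0 mulr0.
have drop_term f' m : (size (msupp f') <= N.+1)%N ->
    (forall g, P g <-> J (g * f')) -> m \in msupp f' -> above D m ->
    exists a, forall g, P g <-> J (g * 'X_[a]).
  move=> szf' Pf' mf' Dm; apply: (IH (f' - f'@_m *: 'X_[m])).
    by rewrite msupp_subC //; lia.
  move=> g; rewrite Pf' mulrBr.
  have Jm : J (g * (f'@_m *: 'X_[m])).
    by rewrite -mul_mpolyC mulrA; apply: JM; apply/mon_idealX.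
  by split=> h; [apply: ideal_sub | apply: ideal_subl h Jm].
have [[g [g0 Pg nPg]] | noexc] :=
    classic (exists g, [/\ g != 0, P g & ~ P 'X_[mlead g]]).
  have f0 : f != 0.
    by apply/eqP => f0; case: P1; apply/Pf; rewrite f0 mulr0.
  (* As [P] is prime and misses the leading monomial of [g], the product has the same annihilator;
     the chosen term is the leading monomial of [g * f], which lies in [J]. *)
  apply: (drop_term (f * 'X_[mlead g]) (mlead g + mlead f)%MM).
  - by rewrite (perm_size (msuppMX _ _)) size_map.
  - move=> h; have -> : h * (f * 'X_[mlead g]) = h * 'X_[mlead g] * f.
      by rewrite mulrA mulrAC.
    by rewrite -Pf; split=> [Ph | /Pp[] //]; rewrite mulrC; apply: PM.
  - by rewrite (perm_mem (msuppMX _ _)); apply/map_f/mlead_supp.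
  - have /mem_mon_ideal := (Pf g).1 Pg; apply.
    by rewrite -mleadM //; apply: mlead_supp; rewrite mulf_neq0.
have Pmon g : P g -> forall m, m \in msupp g -> P 'X_[m].
  move: {2}(size (msupp g)) (leqnn (size (msupp g))) => M.
  elim: M g => [|M IHM] g szg Pg m mg; first by case: (msupp g) szg mg.
  have g0 : g != 0 by apply: contraTneq mg => ->; rewrite msupp0.
  have Pl : P 'X_[mlead g].
    by apply: NNPP => nP; apply: noexc; exists g.
  have [-> // | ml] := eqVneq m (mlead g).
  apply: (IHM (g - g@_(mlead g) *: 'X_[mlead g])).
  - by rewrite msupp_subC ?mlead_supp //; lia.
  - by apply: ideal_sub => //; rewrite -mul_mpolyC; apply: PM.
  - by rewrite (perm_mem (msupp_rem _ _)) mem_rem_uniq ?msupp_uniq // inE ml.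
have Pa g a : P g -> a \in msupp f -> J (g * 'X_[a]).
  move=> Pg af; apply/mon_idealMX => m mg.
  have := (Pf _).1 (Pmon g Pg m mg); rewrite mulrC => /mon_idealMX/(_ a af).
  by rewrite addmC.
apply: NNPP => none.
(* If no term of [f] had annihilator [P], each would be killed by an element outside [P]; the
   product of these is outside the prime [P] and kills [f]. *)
have [g nPg Jg] : exists2 g, ~ P g & forall a, a \in msupp f -> J (g * 'X_[a]).
  have : {subset msupp f <= msupp f} by [].
  elim: {1 3}(msupp f) => [|a r IHr] sub; first by exists 1.
  have [|g nPg Jg] := IHr; first by move=> x xr; apply: sub; rewrite inE xr orbT.
  have [h [Jh nPh]] : exists h, J (h * 'X_[a]) /\ ~ P h.
    apply: NNPP => H; apply: none; exists a => h; split.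
      by move/Pa; apply; apply: sub; rewrite inE eqxx.
    by move=> Jh; apply: NNPP => nPh; apply: H; exists h.
  exists (g * h); first by case/Pp.
  move=> x; rewrite inE => /orP[/eqP-> | /Jg Jx].
    by rewrite -mulrA; apply: JM.
  by rewrite [g * h]mulrC -mulrA; apply: JM.
apply: nPg; apply/Pf; rewrite [f]mpolyE mulr_sumr; apply: ideal_sum => // a af.
by rewrite -mul_mpolyC mulrCA; apply/JM/Jg.
Qed.

(** The variables in [P] form a set [F] satisfying [assoc_cond] for the first bounds, hence for the
    second, where it yields a new witness. Both colon ideals contain the same monomials. *)
Lemma Ass_base_mon k b lo hi b' lo' hi' P :
  PLP_bounds n k b lo hi -> PLP_bounds n k b' lo' hi' ->
  (forall F, assoc_cond n k b lo hi F -> assoc_cond n k b' lo' hi' F) ->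
  Ass (mon_ideal K (base_mon k b lo hi)) P ->
  Ass (mon_ideal K (base_mon k b' lo' hi')) P.
Proof.
move=> H H' Hcond HA; have [primeP _] := HA; split=> //.
have [a Pa] := Ass_mon_ideal HA.
have kn : (k <= n)%N := ltnW (PLP_kn H).
have [F HF] : exists F : nat -> bool,
    forall x, F x <-> exists i : 'I_n, val i = x /\ P 'X_i.
  apply: (functional_choice (fun x (c : bool) =>
    c <-> exists i : 'I_n, val i = x /\ P 'X_i)) => x.
  by have [Q | nQ] := classic (exists i : 'I_n, val i = x /\ P 'X_i);
    [exists true | exists false].
have Pmon m : P 'X_[m] <-> exists x, [/\ (x < n)%N, F x & (0 < mon_fun m x)%N].
  rewrite prime_monomial //; split=> [[i [Pi mi]] | [x [xn /HF [i [ix Pi]]]]].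
    exists i; rewrite ltn_ord mon_funE; split=> //.
    by apply/HF; exists i.
  by rewrite -ix mon_funE; exists i.
have mon_funD (m a' : 'X_{1..n}) x : (x < n)%N ->
    mon_fun (m + a')%MM x = (mon_fun m x + mon_fun a' x)%N.
  by move=> xn; rewrite !(mon_fun_lt _ xn) mnmDE.
have wit : assoc_witness n k b lo hi F.
  exists (mon_fun a) => u; pose m := [multinom u i | i < n].
  have mu x : (x < n)%N -> mon_fun m x = u x by apply: mon_fun_multinom.
  have -> : feasible n k b lo hi (fun x => u x + mon_fun a x)%N <-> P 'X_[m].
    rewrite Pa -mpolyXD mon_idealX above_feasible //.
    by split; apply: eq_feasible => x xn; rewrite mon_funD // mu.
  rewrite Pmon; split=> [[x [xn Fx ux]] | [x [xn Fx ux]]]; exists x; split=> //.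
    by rewrite -mu.
  by rewrite mu.
have [w Hw] := assoc_cond_witness H' (Hcond _ (witness_assoc_cond H wit)).
exists 'X_[[multinom w i | i < n]] => g.
rewrite Pa !mon_idealMX.
suff eqv m : above (base_mon k b lo hi) (m + a)%MM <->
    above (base_mon k b' lo' hi') (m + [multinom w i | i < n])%MM.
  by split=> h m /h /eqv.
rewrite -(mon_idealX K) mpolyXD -[X in X <-> _]Pa Pmon -Hw above_feasible //.
by split; apply: eq_feasible => x xn; rewrite mon_funD // mon_fun_multinom.
Qed.

End AssociatedPrimes.

(** * Powers as dilations *)

Section Powers.
Variables (K : fieldType) (n : nat).

Lemma ideal_mul_mon_ideal (D1 D2 : 'X_{1..n} -> Prop) f :
  ideal_mul (mon_ideal K D1) (mon_ideal K D2) f <->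
  mon_ideal K (fun m => exists u v, [/\ D1 u, D2 v & m = (u + v)%MM]) f.
Proof.
split; move: f; apply: ideal_gen_least; try exact: ideal_gen_ideal.
  move=> _ [f [g [/mem_mon_ideal If /mem_mon_ideal Ig ->]]].
  apply/mem_mon_ideal => m /msuppM_le /allpairsP[[u v] /= [uf vg ->]].
  have [u' D1u le1] := If u uf; have [v' D2v le2] := Ig v vg.
  exists (u' + v')%MM; first by exists u', v'.
  by apply/mnm_lepP => i; rewrite !mnmDE leq_add // ?(mnm_lepP le1) ?(mnm_lepP le2).
move=> _ [_ [u [v [Du Dv ->]]] ->]; rewrite mpolyXD; apply: mem_ideal_gen.
exists 'X_[u], 'X_[v]; split=> //; apply/mon_idealX.
  by exists u => //; apply: lepm_refl.
by exists v => //; apply: lepm_refl.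
Qed.

Lemma eq_mon_ideal (D D' : 'X_{1..n} -> Prop) : (forall u, D u <-> D' u) ->
  forall f, mon_ideal K D f <-> mon_ideal K D' f.
Proof.
move=> DD' f; rewrite !mem_mon_ideal.
by split=> h m /h [u /DD' Du um]; exists u.
Qed.

Lemma eq_ideal_mul (I J J' : {mpoly K[n]} -> Prop) : (forall f, J f <-> J' f) ->
  forall f, ideal_mul I J f <-> ideal_mul I J' f.
Proof.
move=> JJ' f; split; move: f; apply: ideal_gen_least; try exact: ideal_gen_ideal.
  by move=> h [f [g [If /JJ' Jg e]]]; apply: mem_ideal_gen; exists f, g.
by move=> h [f [g [If /JJ' Jg e]]]; apply: mem_ideal_gen; exists f, g.
Qed.

Lemma ideal_pow_base_mon k b lo hi m (f : {mpoly K[n]}) : (k <= n)%N ->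
  ideal_pow (mon_ideal K (base_mon k b lo hi)) m f <->
  mon_ideal K (base_mon k (scale m b) (scale m lo) (scale m hi)) f.
Proof.
move=> kn; elim: m f => [|m IH] f.
  (* For [m = 0] all bounds vanish, so the exponent 0 is allowed and the ideal is the whole ring. *)
  split=> // _; rewrite -[f]mulr1; set J := mon_ideal K _.
  have [_ _] : is_ideal J by apply: mon_ideal_ideal.
  apply; rewrite -mpolyX0; apply/mon_idealX; exists 0%MM; last exact: lepm_refl.
  have z x : mon_fun (0%MM : 'X_{1..n}) x = 0%N.
    by rewrite /mon_fun; case: insub => // i; rewrite mnm0E.
  split=> [x _ | t _]; first by rewrite z.
  by rewrite /psum big1 // => x _; rewrite z.
rewrite /= (eq_ideal_mul _ IH) ideal_mul_mon_ideal; apply: eq_mon_ideal => u.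
split=> [[v [w [Dv Dw ->]]] | Du].
  apply: eq_is_base (is_base_add Dv Dw) => // x xn.
  by rewrite !(mon_fun_lt _ xn) mnmDE.
have [v [w [Dv Dw uvw]]] := is_base_split Du.
exists [multinom v i | i < n], [multinom w i | i < n]; split.
- exact: base_mon_multinom.
- exact: base_mon_multinom.
- by apply/mnmP => i; rewrite mnmDE !mnmE -uvw mon_funE.
Qed.

End Powers.

(** * From the parameters of a left PLP ideal to bounds on all prefixes *)

(* Prefix sums ending before position [k] are only bounded through the first
   constraint, hence by [0] and [beta k]. *)
Definition PLP_lower (n k : nat) (alpha : 'I_n -> nat) t : nat :=
  if (t <= k)%N then 0 else mon_fun alpha t.-1.

Definition PLP_upper (n k : nat) (beta : 'I_n -> nat) t : nat :=
  if t == 0%N then 0 else mon_fun beta (maxn k t.-1).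

Lemma left_PLP_bounds n k d (b alpha beta : 'I_n -> nat) :
  left_PLP_params k d b alpha beta ->
  PLP_bounds n k (mon_fun b) (PLP_lower k alpha) (PLP_upper k beta).
Proof.
move=> [[/andP[k0 kn] d0] Hb Hab Hmono Hlast].
split=> //.
- by move=> x xk; rewrite (mon_fun_lt _ (ltn_trans xk kn)) Hb.
- move=> s t st tn; rewrite /PLP_lower; case: (leqP s k) => // ks.
  have kt : (k < t)%N := leq_trans ks st.
  rewrite (leqNgt t k) kt /=.
  have sn : (s.-1 < n)%N by lia.
  have tn' : (t.-1 < n)%N by lia.
  rewrite (mon_fun_lt _ sn) (mon_fun_lt _ tn').
  by have [] := Hmono (Ordinal sn) (Ordinal tn') _ _ => /=; lia.
- move=> s t st tn; rewrite /PLP_upper; case: eqP => // s0; case: eqP => t0; first by lia.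
  have sn : (maxn k s.-1 < n)%N by lia.
  have tn' : (maxn k t.-1 < n)%N by lia.
  rewrite (mon_fun_lt _ sn) (mon_fun_lt _ tn').
  by have [] := Hmono (Ordinal sn) (Ordinal tn') _ _ => /=; lia.
- move=> t tn; rewrite /PLP_lower /PLP_upper; case: (leqP t k) => // kt.
  have -> : t == 0%N = false by lia.
  have -> : maxn k t.-1 = t.-1 by lia.
  have tn' : (t.-1 < n)%N by lia.
  by rewrite !(mon_fun_lt _ tn') Hab //=; lia.
- by move=> t tk; rewrite /PLP_lower tk.
- move=> t /andP[t0 tk]; rewrite /PLP_upper (gtn_eqF t0) /=.
  by congr (mon_fun _ _); lia.
- have nn : (n.-1 < n)%N by lia.
  rewrite /PLP_lower /PLP_upper (leqNgt n k) kn /=.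
  have -> : n == 0%N = false by lia.
  have -> : maxn k n.-1 = n.-1 by lia.
  rewrite !(mon_fun_lt _ nn).
  by have [|-> ->] := Hlast (Ordinal nn); rewrite /= ?prednK //; lia.
- have nn : (n.-1 < n)%N by lia.
  rewrite /PLP_lower (leqNgt n k) kn /= (mon_fun_lt _ nn).
  by have [|-> _] := Hlast (Ordinal nn); rewrite /= ?prednK //; lia.
Qed.

Lemma left_PLP_exponentE n k d (b alpha beta : 'I_n -> nat) u :
  left_PLP_params k d b alpha beta ->
  left_PLP_exponent k b alpha beta u <->
  base_mon k (mon_fun b) (PLP_lower k alpha) (PLP_upper k beta) u.
Proof.
move=> [[/andP[k0 kn] d0] _ _ _ _].
split=> [[ub us] | [ub us]]; split.
- move=> x xk; have xn := ltn_trans xk kn.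
  by rewrite !(mon_fun_lt _ xn) ub.
- have pre t : (k < t)%N -> (t <= n)%N ->
      (PLP_lower k alpha t <= psum (mon_fun u) t <= PLP_upper k beta t)%N.
    case: t => // t kt tn; have := us (Ordinal tn) kt.
    rewrite /PLP_lower /PLP_upper (leqNgt _ k) kt /= (maxn_idPr (kt : (k <= t)%N)).
    by rewrite !(mon_fun_lt _ tn) psum_mon_fun.
  move=> t tn; case: (ltnP k t) => kt; first exact: pre.
  rewrite /PLP_lower kt /=; case: (posnP t) => [-> | t0]; first by rewrite psum0.
  (* A shorter prefix sum is at most the one of length [k.+1], which is bounded by [beta k]. *)
  have /andP[_] := pre k.+1 (leqnn _) kn; rewrite /PLP_upper (gtn_eqF t0) /=.
  have -> : maxn k t.-1 = k by lia.
  rewrite maxnn; apply: leq_trans.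
  by rewrite /psum (@big_cat_nat _ _ _ t 0 k.+1) //= ?leq_addr //; lia.
- by move=> i ik; have := ub i ik; rewrite !mon_funE.
- move=> i ki; have := us i.+1 (ltn_ord i).
  rewrite /PLP_lower /PLP_upper (leqNgt _ k) ltnS ki /= (maxn_idPr ki) !mon_funE.
  by rewrite psum_mon_fun.
Qed.

Theorem corollary5p10 (K : fieldType) (n k d : nat)
    (b alpha beta : 'I_n -> nat) :
  left_PLP_params k d b alpha beta ->
  is_dstab (left_PLP_ideal K k b alpha beta) 1 /\
  is_astab (left_PLP_ideal K k b alpha beta) 1.
Proof.
move=> params; have H := left_PLP_bounds params.
set b0 := mon_fun b in H; set lo := PLP_lower _ _ in H; set hi := PLP_upper _ _ in H.
have eqI : left_PLP_ideal K k b alpha beta = mon_ideal K (base_mon k b0 lo hi).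
  apply: functional_extensionality => f; apply: propositional_extensionality.
  by apply: eq_mon_ideal => u; apply: left_PLP_exponentE params.
rewrite eqI; set I := mon_ideal K _.
have powE m : ideal_pow I m =
    mon_ideal K (base_mon k (scale m b0) (scale m lo) (scale m hi)).
  apply: functional_extensionality => f; apply: propositional_extensionality.
  exact: ideal_pow_base_mon (ltnW (PLP_kn H)).
have Hm m : (0 < m)%N -> PLP_bounds n k (scale m b0) (scale m lo) (scale m hi).
  by move=> m0; apply: PLP_bounds_scale.
have depth_pow m : (0 < m)%N ->
    has_depth (ideal_pow I m) (size (tight_vars n lo hi)).-1.
  move=> m0; rewrite powE.
  (* A positive dilation keeps the same positions tight, hence the same number of blocks. *)
  have -> : tight_vars n lo hi = tight_vars n (scale m lo) (scale m hi).
    by apply: eq_filter => i; rewrite /scale eqn_pmul2l.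
  exact: base_mon_depth (Hm m m0).
have Ass_pow m m' P : (0 < m)%N -> (0 < m')%N ->
    Ass (ideal_pow I m) P -> Ass (ideal_pow I m') P.
  move=> m0 m'0; rewrite !powE.
  apply: Ass_base_mon (Hm m m0) (Hm m' m'0) _ => F cF.
  apply/(assoc_cond_scale _ _ _ _ _ _ m'0).
  exact/(assoc_cond_scale _ _ _ _ _ _ m0).
split; split=> // l l0.
  by exists (size (tight_vars n lo hi)).-1; apply: depth_pow.
by move=> P; split; apply: Ass_pow.
Qed.
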